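(* Consider the iterates of Algorithm S-PStorm (described in the context) applied to $\min_{x\in\mathbb{R}^n} f(x)+r(x)$, and suppose that assumptions (A), (B) and (C) of the context hold with $\underline{\alpha}=\mu_f/L_g^2$, $\zeta\in(0,2)$, and $c=(2\theta L_g^2)/(\zeta\mu_f^2)>2$ for some $\theta\ge2$. Let $\underline{k}=\lceil 2c-1\rceil$, let $\eta_0\in(0,6/\pi^2)$, and let $x^*$ be the unique minimizer of $f+r$. Then there exists a constant $C_3>0$ independent of $k$ such that the events $$\mathcal{E}^x_k:=\left\{\|x_k-x^*\|^2\le\bar c_1\frac{\|x_{\underline{k}}-x^*\|^2}{k^\theta}+\bar c_2\cdot\frac{\log\frac{2k}{\eta_0}}{k}\right\},$$ with $\bar c_1:=(\underline{k}+2)^\theta$ and $$\bar c_2:=C_3\,\zeta\left(\frac{\mu_f^2}{L_g^4}+\frac{2}{L_g^2}\left(1+\frac{\mu_f}{L_g}\right)^2\right)\big(\sigma+L_g(G_r+G_d)\zeta\underline{\alpha}\big)^2,$$ satisfy $$\mathbb{P}\left(\bigcap_{k\ge\underline{k}}\mathcal{E}^x_k\right)\ge1-\frac{\eta_0\pi^2}{6}>0.$$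
   Context: $\|\cdot\|$ is the Euclidean norm. Problem: $\min_{x\in\mathbb{R}^n}F(x):=f(x)+r(x)$, where $f(x)=\mathbb{E}_{\xi\sim\mathcal{P}}[\ell(x;\xi)]$ for a random vector $\xi$ with distribution $\mathcal{P}$, $\ell(\cdot;\xi)$ is almost surely smooth (differentiable) and convex, and $r(x)=\sum_{i=1}^{n_{\mathcal G}}r_i([x]_{g_i})$ with $\{g_i\}_{i=1}^{n_{\mathcal G}}$ a partition of $\{1,\dots,n\}$ and $[x]_{g_i}$ the subvector of $x$ indexed by $g_i$. The proximal operator is $\mathrm{prox}_{\alpha r}(z)=\arg\min_{x}\{\frac{1}{2\alpha}\|x-z\|^2+r(x)\}$. Algorithm S-PStorm. Inputs: $x_0=x_1\in\mathbb{R}^n$, mini-batch size $m\in\mathbb{N}_+$, weights $\beta_k\in(0,1)$, stepsizes $\alpha_k>0$, parameter $\zeta\in(0,\infty)$. For $k=1,2,\dots$: draw $m$ i.i.d. samples $\xi_{k1},\dots,\xi_{km}$ from $\mathcal{P}$ (independent of all earlier samples); set $v_k=\frac1m\sum_{i=1}^m\nabla\ell(x_k;\xi_{ki})$; if $k=1$ set $d_1=v_1$, otherwise set $u_k=\frac1m\sum_{i=1}^m\nabla\ell(x_{k-1};\xi_{ki})$ and $d_k=v_k+(1-\beta_k)(d_{k-1}-u_k)$; set $y_k=\mathrm{prox}_{\alpha_k r}(x_k-\alpha_k d_k)$; set $x_{k+1}=x_k+\zeta\beta_k(y_k-x_k)$. Filtration: $\mathcal{F}_1=\sigma(x_1)$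 and, for $k\ge2$, $\mathcal{F}_k$ is the $\sigma$-algebra generated by the samples of iterations $1,\dots,k-1$. Assumption (A): (1) $f$ is $\mu_f$-strongly convex on $\mathbb{R}^n$ ($\mu_f>0$) and every $r_i$ is a real-valued closed convex function. (2) There is $L_g>0$ such that $\|\nabla\ell(x;\xi)-\nabla\ell(y;\xi)\|\le L_g\|x-y\|$ for all $x,y\in\mathbb{R}^n$ and every $\xi\sim\mathcal{P}$; in particular $\nabla f$ is $L_g$-Lipschitz. Assumption (B): for all $k\ge1$ (with $\xi\sim\mathcal{P}$ independent of $\mathcal{F}_k$): (1) $\mathbb{E}_{\xi\sim\mathcal{P}}[\nabla\ell(x_k;\xi)\mid\mathcal{F}_k]=\nabla f(x_k)$; (2) there is $G_r>0$, independent of $k$, with $\mathbb{P}\{\|g\|\le G_r\ \forall g\in\partial r(x_k)\}=1$; (3) there is $\sigma>0$, independent of $k$, with $\mathbb{P}_{\xi\sim\mathcal{P}}\{\|\nabla\ell(x_k;\xi)-\nabla f(x_k)\|\le\sigma\mid\mathcal{F}_k\}=1$; (4) there is $G_d>0$, independent of $k$, with $\mathbb{P}\{\|d_k\|\le G_d\mid\mathcal{F}_k\}=1$. Assumption (C): for constants $c>1$ and $\underline{\alpha}\in(0,\infty)$, $\beta_k=\min\{1/2,\,c/(k+1)\}$ and $\alpha_k=\underline{\alpha}$ for all $k\ge1$. *)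

(* Defs.v *)
From HB Require Import structures.
From mathcomp Require Import all_boot all_order all_algebra.
From mathcomp Require Import all_classical all_reals all_analysis.
Set Implicit Arguments.
Unset Strict Implicit.
Unset Printing Implicit Defensive.
Import Order.TTheory GRing.Theory Num.Theory.
Import numFieldNormedType.Exports.
Local Open Scope classical_set_scope.
Local Open Scope ring_scope.

(* The library norm on ['rV[R]_n] is the sup norm, hence [dotp] and [enorm]. *)
Definition dotp (R : realType) (n : nat) (u v : 'rV[R]_n) : R :=
  \sum_(i < n) u 0 i * v 0 i.

Definition enorm (R : realType) (n : nat) (u : 'rV[R]_n) : R :=
  Num.sqrt (dotp u u).

(* [R^n] with its Borel sigma-algebra; convertible to ['rV[R]_n]. *)
Definition Rvec (R : realType) (n : nat) :=
  g_sigma_algebraType (@open 'rV[R]_n).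

(* Meaningful only where [f] is differentiable: the library's directional
   derivative is total. *)
Definition grad (R : realType) (n : nat) (f : 'rV[R]_n -> R) (x : 'rV[R]_n) :
    'rV[R]_n :=
  \row_(i < n) 'D_(delta_mx 0 i) f x.

Definition convex_on_space (R : realType) (n : nat) (f : 'rV[R]_n -> R) : Prop :=
  convex_function [set: convex_lmodType 'rV[R]_n] f.

Definition strongly_convex (R : realType) (n : nat) (mu : R)
    (f : 'rV[R]_n -> R) : Prop :=
  forall (x y : 'rV[R]_n) (t : R), 0 <= t <= 1 ->
    f (t *: x + (1 - t) *: y) <=
      t * f x + (1 - t) * f y - mu / 2 * t * (1 - t) * enorm (x - y) ^+ 2.

Definition closed_function (R : realType) (n : nat) (f : 'rV[R]_n -> R) : Prop :=
  closed [set z : 'rV[R]_n * R | f z.1 <= z.2].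

Definition subdifferential (R : realType) (n : nat) (f : 'rV[R]_n -> R)
    (x : 'rV[R]_n) : set 'rV[R]_n :=
  [set g | forall y, f x + dotp g (y - x) <= f y].

Definition argmin (R : realType) (n : nat) (f : 'rV[R]_n -> R) :
    set 'rV[R]_n :=
  [set x | forall z, f x <= f z].

(* A set; for [0 < alpha] and [r] convex it has at most one element. *)
Definition prox (R : realType) (n : nat) (alpha : R) (r : 'rV[R]_n -> R)
    (z : 'rV[R]_n) : set 'rV[R]_n :=
  argmin (fun x => (2 * alpha)^-1 * enorm (x - z) ^+ 2 + r x).

Definition subvec (R : realType) (n : nat) (A : {set 'I_n}) (x : 'rV[R]_n) :
    'rV[R]_#|A| :=
  \row_(j < #|A|) x 0 (enum_val j).

Definition group_partition (n nG : nat) (g : 'I_nG -> {set 'I_n}) : Prop :=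
  injective g /\ finset.partition [set g i | i : 'I_nG]%SET [set: 'I_n]%SET.

Definition group_sum (R : realType) (n nG : nat) (g : 'I_nG -> {set 'I_n})
    (r_ : forall i : 'I_nG, 'rV[R]_#|g i| -> R) (x : 'rV[R]_n) : R :=
  \sum_(i < nG) r_ i (subvec (g i) x).

Definition expected_loss (R : realType) (n p : nat)
    (Pxi : probability (Rvec R p) R) (l : 'rV[R]_n -> Rvec R p -> R)
    (x : 'rV[R]_n) : R :=
  fine 'E_Pxi[l x].

Definition gradl (R : realType) (n p : nat) (l : 'rV[R]_n -> Rvec R p -> R)
    (x : 'rV[R]_n) (s : Rvec R p) : 'rV[R]_n :=
  grad (fun z => l z s) x.

Section probability_notions.
Context (d : measure_display) (T : measurableType d) (R : realType)
  (P : probability T R).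

Definition mutually_independent (I : choiceType) (d' : measure_display)
    (T' : measurableType d') (D : set I) (X : I -> T -> T') : Prop :=
  forall (J : seq I) (A : I -> set T'), uniq J -> [set` J] `<=` D ->
    (forall j, measurable (A j)) ->
    P (\bigcap_(j in [set` J]) X j @^-1` A j) =
      (\prod_(j <- J) fine (P (X j @^-1` A j)))%:E.

Definition independent_of (d' : measure_display) (T' : measurableType d')
    (G : set (set T)) (X : T -> T') : Prop :=
  forall (A : set T) (B : set T'), G A -> measurable B ->
    P (A `&` X @^-1` B) = (P A * P (X @^-1` B))%E.

(* [Y] is a version of the conditional expectation of [X] given the
   sigma-algebra [G]. *)
Definition is_cond_exp (G : set (set T)) (X Y : T -> R) : Prop :=
  [/\ P.-integrable [set: T] (EFin \o X),
      P.-integrable [set: T] (EFin \o Y),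
      forall B : set R, measurable B -> G (Y @^-1` B) &
      forall A, G A ->
        (\int[P]_(w in A) (X w)%:E = \int[P]_(w in A) (Y w)%:E)%E].

Definition is_cond_prob (G : set (set T)) (A : set T) (Y : T -> R) : Prop :=
  is_cond_exp G \1_A Y.

End probability_notions.

(* [xi k i] is the [i]-th sample of iteration [k >= 1]; [xi 0] is never used. *)
Definition iid_samples (d : measure_display) (T : measurableType d)
    (R : realType) (P : probability T R) (p m : nat)
    (Pxi : probability (Rvec R p) R)
    (xi : nat -> 'I_m -> {RV P >-> Rvec R p}) : Prop :=
  (forall (k : nat) (i : 'I_m) (A : set (Rvec R p)),
     (1 <= k)%N -> measurable A -> distribution P (xi k i) A = Pxi A) /\
  mutually_independent P [set ki : nat * 'I_m | (1 <= ki.1)%N]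
    (fun ki => xi ki.1 ki.2).

(* [(x, d, y)] are the iterates produced along every sample path. *)
Definition S_PStorm (T : Type) (R : realType) (n p m : nat)
    (r : 'rV[R]_n -> R) (l : 'rV[R]_n -> Rvec R p -> R)
    (xi : nat -> 'I_m -> T -> Rvec R p)
    (xinit : 'rV[R]_n) (beta alpha : nat -> R) (zeta : R)
    (x d y : nat -> T -> 'rV[R]_n) : Prop :=
  forall w : T,
    let v k := m%:R^-1 *: \sum_(i < m) gradl l (x k w) (xi k i w) in
    let u k := m%:R^-1 *: \sum_(i < m) gradl l (x k.-1 w) (xi k i w) in
    [/\ x 0%N w = xinit /\ x 1%N w = xinit,
        d 1%N w = v 1%N,
        forall k, (2 <= k)%N ->
          d k w = v k + (1 - beta k) *: (d k.-1 w - u k),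
        forall k, (1 <= k)%N ->
          prox (alpha k) r (x k w - alpha k *: d k w) (y k w) &
        forall k, (1 <= k)%N ->
          x k.+1 w = x k w + (zeta * beta k) *: (y k w - x k w)].

Definition filtration (d : measure_display) (T : measurableType d)
    (R : realType) (n p m : nat) (x : nat -> T -> 'rV[R]_n)
    (xi : nat -> 'I_m -> T -> Rvec R p) (k : nat) : set (set T) :=
  if (k <= 1)%N then
    preimage_set_system [set: T] (x 1%N : T -> Rvec R n) measurable
  else
    <<s \bigcup_(j in [set j | (1 <= j < k)%N]) \bigcup_(i in [set: 'I_m])
          preimage_set_system [set: T] (xi j i) measurable >>.

(* The integrability and measurability clauses are what makes the expected loss
   finite and the iterates random vectors. *)
Definition stochastic_loss (R : realType) (n p : nat)
    (Pxi : probability (Rvec R p) R) (l : 'rV[R]_n -> Rvec R p -> R) : Prop :=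
  [/\ forall x, Pxi.-integrable [set: Rvec R p] (EFin \o l x),
      forall i : 'I_n, measurable_fun [set: Rvec R n * Rvec R p]
        (fun z : Rvec R n * Rvec R p => gradl l z.1 z.2 0 i) &
      {ae Pxi, forall s, (forall x : 'rV[R]_n, differentiable (fun z => l z s) x) /\
                         convex_on_space (fun z => l z s)}].

(* The Lipschitz bound is imposed on every [s] for which [gradl l ^~ s] is a
   genuine gradient. *)
Definition lipschitz_gradients (R : realType) (n p : nat) (Lg : R)
    (Pxi : probability (Rvec R p) R) (l : 'rV[R]_n -> Rvec R p -> R) : Prop :=
  let f := expected_loss Pxi l in
  [/\ forall s, (forall x : 'rV[R]_n, differentiable (fun z => l z s) x) ->
        forall x y, enorm (gradl l x s - gradl l y s) <= Lg * enorm (x - y),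
      forall x : 'rV[R]_n, differentiable f x &
      forall x y, enorm (grad f x - grad f y) <= Lg * enorm (x - y)].

Definition oracle_and_iterate_bounds (d : measure_display)
    (T : measurableType d) (R : realType) (P : probability T R) (n p m : nat)
    (Pxi : probability (Rvec R p) R) (l : 'rV[R]_n -> Rvec R p -> R)
    (r : 'rV[R]_n -> R) (xi : nat -> 'I_m -> {RV P >-> Rvec R p})
    (x dir : nat -> T -> 'rV[R]_n) (Gr sigma Gd : R) : Prop :=
  let f := expected_loss Pxi l in
  let F := filtration x (fun k i => xi k i : T -> Rvec R p) in
  forall k, (1 <= k)%N ->
  [/\ (* [xi'] is a fresh draw from [Pxi], e.g. any [xi k i] *)
      forall xi' : {RV P >-> Rvec R p},
        (forall A, measurable A -> distribution P xi' A = Pxi A) ->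
        independent_of P (F k) xi' ->
        (forall i : 'I_n,
           is_cond_exp P (F k) (fun w => gradl l (x k w) (xi' w) 0 i)
                               (fun w => grad f (x k w) 0 i)) /\
        is_cond_prob P (F k)
          [set w | enorm (gradl l (x k w) (xi' w) - grad f (x k w)) <= sigma]
          (cst 1),
      {ae P, forall w, forall g, subdifferential r (x k w) g -> enorm g <= Gr} &
      is_cond_prob P (F k) [set w | enorm (dir k w) <= Gd] (cst 1)].

(* Main.v *)
Require Import Defs.
From HB Require Import structures.
From mathcomp Require Import all_boot all_order all_algebra.
From mathcomp Require Import all_classical all_reals all_analysis.
From mathcomp Require Import measurable_realfun.
From mathcomp Require Import ring lra.
Set Implicit Arguments.
Unset Strict Implicit.
Unset Printing Implicit Defensive.
Import Order.TTheory GRing.Theory Num.Theory.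
Import numFieldNormedType.Exports.
Local Open Scope classical_set_scope.
Local Open Scope ring_scope.

(** The estimation error [eps_k = dir_k - grad f (x_k)] obeys
    [eps_k = (1 - beta_k) eps_(k-1) + w_k], where [w_k] is centered given the past
    and [O(beta_k)] in norm: the oracle error enters with weight [beta_k], the
    remainder is controlled by the step length [O(beta_k)]. Hence the coordinates of
    [eps_k] are subgaussian with variance proxy [O(1/k)], and a union bound gives
    [|eps_k|^2 <= B ln(2k/eta) / k] for all [k] simultaneously. On that event
    one step contracts, [D_(k+1) <= (1 - theta/(k+1)) D_k + K ln(2k/eta) / (k(k+1))]
    for [D_k = |x_k - x*|^2], which yields the claimed rate by induction. As [C3] may
    depend on everything but [k], [B] is allowed to depend on the dimension and
    on [eta], so that scalar exponential-moment bounds suffice. *)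

(** * Euclidean geometry *)

(** No conditional expectation is computed. Each increment evaluates a fresh draw at both x_k and
    x_(k-1), so unbiasedness is proved at every fixed point; independence makes the joint law of the
    past and the draw a product, and Fubini integrates the draw with the past frozen. This requires
    the iterates to be random vectors determined by the past samples, which has to be proved: [y] is
    only some element of the set [prox], and its measurability comes from nonexpansiveness. The
    stepsize mu / L^2 minimizes 1 - 2 a mu + a^2 L^2, the squared factor of a gradient step, and c
    is what turns zeta beta_k mu^2 / (2 L^2) into theta / (k+1) as soon as beta_k = c / (k+1). *)

Section euclid.
Context {R : realType} {n : nat}.
Implicit Types (u v w : 'rV[R]_n) (a : R).

Lemma dotpC u v : dotp u v = dotp v u.
Proof. by apply: eq_bigr => i _; rewrite mulrC. Qed.

Lemma dotpDl u v w : dotp (u + v) w = dotp u w + dotp v w.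
Proof. by rewrite /dotp -big_split; apply: eq_bigr => i _; rewrite mxE mulrDl. Qed.

Lemma dotpDr u v w : dotp w (u + v) = dotp w u + dotp w v.
Proof. by rewrite dotpC dotpDl !(dotpC w). Qed.

Lemma dotpZl a u v : dotp (a *: u) v = a * dotp u v.
Proof. by rewrite /dotp mulr_sumr; apply: eq_bigr => i _; rewrite mxE mulrA. Qed.

Lemma dotpZr a u v : dotp u (a *: v) = a * dotp u v.
Proof. by rewrite dotpC dotpZl dotpC. Qed.

Lemma dotpNl u v : dotp (- u) v = - dotp u v.
Proof. by rewrite -scaleN1r dotpZl mulN1r. Qed.

Lemma dotpNr u v : dotp u (- v) = - dotp u v.
Proof. by rewrite dotpC dotpNl dotpC. Qed.

Lemma dotp0l u : dotp 0 u = 0.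
Proof. by rewrite -(scale0r 0) dotpZl mul0r. Qed.

Lemma dotp_delta u (i : 'I_n) : dotp u (delta_mx 0 i) = u 0 i.
Proof.
rewrite /dotp (bigD1 i)//= mxE !eqxx mulr1 big1 ?addr0// => j ji.
by rewrite mxE (negbTE ji) andbF mulr0.
Qed.

Definition dotpE := (dotpDl, dotpDr, dotpNl, dotpNr, dotpZl, dotpZr).

Lemma dotp_ge0 u : 0 <= dotp u u.
Proof. by apply: sumr_ge0 => i _; rewrite -expr2 sqr_ge0. Qed.

Lemma enorm_ge0 u : 0 <= enorm u.
Proof. exact: sqrtr_ge0. Qed.

Lemma sqr_enorm u : enorm u ^+ 2 = dotp u u.
Proof. by rewrite sqr_sqrtr// dotp_ge0. Qed.

Lemma enorm0 : enorm (0 : 'rV[R]_n) = 0.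
Proof. by rewrite /enorm dotp0l sqrtr0. Qed.

Lemma dotp_eq0 u : dotp u u = 0 -> u = 0.
Proof.
move/eqP; rewrite psumr_eq0 => [|i _]; last by rewrite -expr2 sqr_ge0.
move=> /allP h; apply/rowP => i; rewrite mxE; apply/eqP.
by have := h i; rewrite mem_index_enum mulf_eq0 orbb; apply.
Qed.

Lemma dotp_le u v : dotp u v <= enorm u * enorm v.
Proof.
have h : dotp u v ^+ 2 <= dotp u u * dotp v v.
  have [/dotp_eq0 ->|u0] := eqVneq (dotp u u) 0; first by rewrite !dotp0l expr0n mul0r.
  have up : 0 < dotp u u by rewrite lt_def u0 dotp_ge0.
  (* This is the part of [v] orthogonal to [u], scaled by [dotp u u] to avoid a division. *)
  have := dotp_ge0 (dotp u u *: v - dotp u v *: u).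
  rewrite !dotpE (dotpC v u) => h.
  rewrite -subr_ge0 -(pmulr_rge0 _ up); apply: le_trans h _.
  by rewrite le_eqVlt; apply/orP; left; apply/eqP; ring.
have [uv0|uv0] := lerP 0 (dotp u v); last first.
  by rewrite (le_trans (ltW uv0))// mulr_ge0// enorm_ge0.
rewrite -(@ler_pXn2r _ 2)// ?nnegrE ?mulr_ge0 ?enorm_ge0//.
by rewrite exprMn !sqr_enorm.
Qed.

Lemma enormZ a u : enorm (a *: u) = `|a| * enorm u.
Proof. by rewrite /enorm dotpZl dotpZr mulrA -expr2 sqrtrM ?sqr_ge0// sqrtr_sqr. Qed.

Lemma enormN u : enorm (- u) = enorm u.
Proof. by rewrite -scaleN1r enormZ normrN1 mul1r. Qed.

Lemma enormBC u v : enorm (u - v) = enorm (v - u).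
Proof. by rewrite -opprB enormN. Qed.

Lemma norm_dotp_le u v : `|dotp u v| <= enorm u * enorm v.
Proof.
rewrite ler_norml dotp_le andbT lerNl -dotpNl.
by rewrite (le_trans (dotp_le _ _))// enormN.
Qed.

Lemma ler_enormD u v : enorm (u + v) <= enorm u + enorm v.
Proof.
rewrite -(@ler_pXn2r _ 2)// ?nnegrE ?addr_ge0 ?enorm_ge0//.
rewrite sqr_enorm !dotpE (dotpC v u) sqrrD !sqr_enorm.
by have := dotp_le u v; lra.
Qed.

Lemma ler_enormB u v : enorm (u - v) <= enorm u + enorm v.
Proof. by rewrite (le_trans (ler_enormD _ _))// enormN. Qed.

Lemma ler_dist_enorm u v : `|enorm u - enorm v| <= enorm (u - v).
Proof.
have h (a b : 'rV[R]_n) : enorm a - enorm b <= enorm (a - b).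
  by rewrite lerBlDr -{1}(subrK b a) ler_enormD.
by rewrite ler_norml h andbT lerNl opprB enormBC h.
Qed.

Lemma ler_enorm_sum (I : finType) (F : I -> 'rV[R]_n) :
  enorm (\sum_i F i) <= \sum_i enorm (F i).
Proof.
elim/big_ind2 : _ => [|u a v b ua vb|//]; first by rewrite enorm0.
by rewrite (le_trans (ler_enormD _ _))// lerD.
Qed.

Lemma coord_le_enorm u (i : 'I_n) : `|u 0 i| <= enorm u.
Proof.
rewrite -(@ler_pXn2r _ 2)// ?nnegrE ?enorm_ge0// sqr_enorm real_normK ?num_real//.
by rewrite /dotp (bigD1 i)//= expr2 lerDl; apply: sumr_ge0 => j _; rewrite -expr2 sqr_ge0.
Qed.

Lemma enorm_delta (i : 'I_n) : enorm (delta_mx 0 i : 'rV[R]_n) = 1.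
Proof. by rewrite /enorm dotp_delta mxE !eqxx sqrtr1. Qed.


Lemma sqr_enorm_convex (t : R) u v : 0 <= t <= 1 ->
  enorm ((1 - t) *: u + t *: v) ^+ 2 <= (1 - t) * enorm u ^+ 2 + t * enorm v ^+ 2.
Proof.
move=> /andP[t0 t1]; rewrite !sqr_enorm.
have t1' : 0 <= 1 - t by rewrite subr_ge0.
have := mulr_ge0 (mulr_ge0 t0 t1') (dotp_ge0 (u - v)).
by rewrite !dotpE (dotpC v u); lra.
Qed.

(** Young's inequality: the two sides differ by [q^-1 * enorm (q *: u - v) ^+ 2]. *)
Lemma sqr_enormD_le (q : R) u v : 0 < q ->
  enorm (u + v) ^+ 2 <= (1 + q) * enorm u ^+ 2 + (1 + q^-1) * enorm v ^+ 2.
Proof.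
move=> q0; rewrite !sqr_enorm.
have q0' : 0 <= q^-1 by rewrite invr_ge0 ltW.
have := mulr_ge0 q0' (dotp_ge0 (q *: u - v)).
have -> : q^-1 * dotp (q *: u - v) (q *: u - v) =
    q * dotp u u - 2 * dotp u v + q^-1 * dotp v v.
  by rewrite !dotpE (dotpC v u); field; rewrite gt_eqF.
by rewrite !dotpE (dotpC v u); lra.
Qed.

End euclid.

(** * Convexity, subgradients and proximal steps *)

Section convex.
Context {R : realType} {n : nat}.
Implicit Types (r : 'rV[R]_n -> R) (x y z u v : 'rV[R]_n).

(** Convexity with a bare real weight instead of an element of an interval type, so that convex
    combinations are ordinary linear expressions. *)
Definition jensen r := forall x y (t : R), 0 <= t <= 1 ->
  r (t *: x + (1 - t) *: y) <= t * r x + (1 - t) * r y.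

Lemma convex_on_space_jensen r : convex_on_space r -> jensen r.
Proof.
move=> cr x y t /andP[t0 t1].
have tt : Itv.spec (Itv.num_sem (R:=R)) (Itv.Real `[0%Z, 1%Z]) t.
  by apply/andP; split; [exact: ger0_real|rewrite /= in_itv/= t0 t1].
by have := cr (Itv.mk tt) x y (in_setT _) (in_setT _).
Qed.

(** [Gr] bounds every subgradient at an iterate; the step length estimate needs that there is
    one. *)
Lemma subgradient_exists r x : jensen r -> exists g, subdifferential r x g.
Proof.
move=> cr; pose p v := r (x + v) - r x.
(* Convexity of [p] at the weights [t / (s + t)] and [s / (s + t)], multiplied by [s + t]. *)
have cp u v (s t : R) : 0 < s -> 0 < t ->
    (s + t) * p ((s + t)^-1 *: (t *: u + s *: v)) <= t * p u + s * p v.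
  move=> s0 t0; have st0 : 0 < s + t by rewrite addr_gt0.
  have := cr (x + u) (x + v) (t / (s + t)).
  have e1 : 1 - t / (s + t) = s / (s + t) by field; rewrite gt_eqF.
  have t01 : 0 <= t / (s + t) <= 1.
    by rewrite divr_ge0 ?(ltW t0) ?(ltW st0)//= ler_pdivrMr// mul1r lerDr ltW.
  rewrite e1 => /(_ t01) h.
  have e2 : t / (s + t) *: (x + u) + s / (s + t) *: (x + v) =
      x + (s + t)^-1 *: (t *: u + s *: v).
    rewrite !scalerDr addrACA -scalerDl -mulrDl (addrC t) divff ?gt_eqF// scale1r.
    by rewrite !scalerA mulrC (mulrC s).
  rewrite e2 in h; rewrite /p.
  have := ler_wpM2l (ltW st0) h.
  have -> : (s + t) * (t / (s + t) * r (x + u) + s / (s + t) * r (x + v)) =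
    t * r (x + u) + s * r (x + v) by field; rewrite gt_eqF.
  by lra.
(* Hahn-Banach: a linear minorant is extended one coordinate at a time. *)
have H (k : nat) : (k <= n)%N -> exists a, forall v,
    (forall i : 'I_n, (k <= i)%N -> v 0 i = 0) -> dotp a v <= p v.
  elim: k => [_|k IH kn].
    exists 0 => v v0; have -> : v = 0 by apply/rowP => i; rewrite mxE v0.
    by rewrite dotp0l /p addr0 subrr.
  have [a ha] := IH (ltnW kn).
  pose k' := Ordinal kn; pose e : 'rV[R]_n := delta_mx 0 k'.
  pose V := [set v : 'rV[R]_n | forall i : 'I_n, (k <= i)%N -> v 0 i = 0].
  (* Slopes in direction [- e] bound the new coordinate from below, slopes in direction [e] from
     above. By [Sub] no lower bound exceeds an upper one, so [sup S] is admissible. *)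
  pose S := [set q : R | exists u (s : R),
    [/\ V u, 0 < s & q = (dotp a u - p (u - s *: e)) / s]].
  have Sub v (t : R) : V v -> 0 < t -> ubound S ((p (v + t *: e) - dotp a v) / t).
    move=> Vv t0 q [u [s [Vu s0 ->]]].
    rewrite ler_pdivrMr// mulrAC ler_pdivlMr//.
    have st0 : 0 < s + t by rewrite addr_gt0.
    have := cp (u - s *: e) (v + t *: e) s t s0 t0.
    have -> : t *: (u - s *: e) + s *: (v + t *: e) = t *: u + s *: v.
      rewrite !scalerDr scalerN !scalerA (mulrC t s) addrACA.
      by rewrite addNr addr0.
    have := ha ((s + t)^-1 *: (t *: u + s *: v)).
    have Vw : V ((s + t)^-1 *: (t *: u + s *: v)).
      by move=> i ki; rewrite !mxE Vu// Vv// !mulr0 addr0 mulr0.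
    move=> /(_ Vw) /(ler_wpM2l (ltW st0)).
    rewrite dotpZr mulrA divff ?gt_eqF// mul1r !dotpE.
    by lra.
  have V0 : V 0 by move=> i _; rewrite mxE.
  have S0 : S !=set0 by exists ((dotp a 0 - p (0 - 1 *: e)) / 1); exists 0, 1.
  have hS : has_sup S by split => //; exists ((p (0 + 1 *: e) - dotp a 0) / 1); exact: Sub.
  (* [a] is only tested on vectors that vanish from index [k] on, so its entry at [k'] is arbitrary
     and is overwritten by [sup S]. *)
  exists (a + (sup S - a 0 k') *: e) => v hv.
  pose v' : 'rV[R]_n := v - v 0 k' *: e.
  have Vv' : V v'.
    move=> i; rewrite leq_eqVlt => /orP[/eqP ki|ki].
      have -> : i = k' by apply/val_inj.
      by rewrite !mxE !eqxx mulr1 /= addrN.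
    rewrite !mxE (hv i ki).
    have -> : (i == k') = false by apply/negbTE/eqP => ik; rewrite ik ltnn in ki.
    by rewrite andbF mulr0 subr0.
  have vE : v = v' + v 0 k' *: e by rewrite subrK.
  have -> : dotp (a + (sup S - a 0 k') *: e) v = dotp a v' + sup S * v 0 k'.
    rewrite dotpDl dotpZl (dotpC e) dotp_delta /v' dotpDr dotpNr dotpZr dotp_delta.
    by ring.
  have [t0|t0|t0] := ltgtP (v 0 k') 0.
  - have s0 : 0 < - v 0 k' by rewrite oppr_gt0.
    have : S ((dotp a v' - p v) / (- v 0 k')).
      by exists v', (- v 0 k'); rewrite scaleNr opprK -vE.
    move=> /(sup_upper_bound hS); rewrite ler_pdivrMr//.
    by lra.
  - have := @ge_sup _ S _ S0 (Sub v' _ Vv' t0).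
    rewrite ler_pdivlMr// -vE; lra.
  - by rewrite t0 mulr0 addr0 [in p v]vE t0 scale0r addr0 ha.
have [g hg] := H n (leqnn _).
exists g => y; have := hg (y - x); rewrite /p [x + _]addrC subrK => h.
by rewrite -lerBrDl h// => i; rewrite leqNgt ltn_ord.
Qed.

(** Divide by [t] and let [t] tend to 0. The first-order conditions below go through this lemma
    instead of limits. *)
Lemma ge0_of_quadratic_slope (a K : R) :
  (forall t, 0 < t <= 1 -> 0 <= t * a + K * t ^+ 2) -> 0 <= a.
Proof.
move=> h; rewrite leNgt; apply/negP => a0.
pose K' := `|K| + 1; have K'0 : 0 < K' by rewrite ltr_wpDl.
(* At this [t] the quadratic term is at most half of [- t * a]. *)
pose t := Num.min 1 (- a / (2 * K')).
have t0 : 0 < t by rewrite lt_min ltr01 divr_gt0 ?oppr_gt0 ?mulr_gt0.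
have t1 : t <= 1 by rewrite ge_min lexx.
have := h t; rewrite t0 t1 => /(_ isT).
have -> : t * a + K * t ^+ 2 = t * (a + K * t) by ring.
rewrite pmulr_rge0// leNgt => /negP; apply.
have : K * t <= K' * t by rewrite ler_pM2r// /K' (le_trans (ler_norm _))// lerDl.
have : K' * t <= - a / 2.
  rewrite -ler_pdivlMl//; apply: (@le_trans _ _ (- a / (2 * K'))).
    by rewrite ge_min lexx orbT.
  by rewrite le_eqVlt; apply/orP; left; apply/eqP; field; rewrite gt_eqF.
lra.
Qed.

Lemma subdifferential_monotone r x y g h :
  subdifferential r x g -> subdifferential r y h -> 0 <= dotp (g - h) (x - y).
Proof.
move=> /(_ y) gx /(_ x) hy; move: gx hy.
by rewrite -(opprB x y) !dotpE; lra.
Qed.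

(** Fermat's rule along the segment from [x] to [z]. An upper quadratic bound on [h] at [x] is
    enough, and both the quadratic of [prox] and a smooth [f] provide one. *)
Lemma argmin_subdifferential (h r : 'rV[R]_n -> R) x g (K : R) : jensen r ->
  (forall v, h (x + v) <= h x + dotp g v + K * enorm v ^+ 2) ->
  argmin (fun z => h z + r z) x -> subdifferential r x (- g).
Proof.
move=> cr hK minx z.
suff: 0 <= dotp g (z - x) + (r z - r x) by rewrite dotpNl; lra.
apply: (@ge0_of_quadratic_slope _ (K * enorm (z - x) ^+ 2)) => t /andP[t0 t1].
have := minx (x + t *: (z - x)).
have := hK (t *: (z - x)).
have := cr z x t; rewrite (ltW t0) t1 => /(_ isT).
have -> : t *: z + (1 - t) *: x = x + t *: (z - x).
  by rewrite scalerBl scale1r scalerBr addrCA addrA.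
rewrite dotpZr enormZ exprMn real_normK ?num_real//.
by lra.
Qed.

Lemma prox_subdifferential r (a : R) z y : 0 < a -> jensen r ->
  prox a r z y -> subdifferential r y (a^-1 *: (z - y)).
Proof.
move=> a0 cr; rewrite -(opprB y z) scalerN.
apply: (@argmin_subdifferential (fun x => (2 * a)^-1 * enorm (x - z) ^+ 2)
  r y _ (2 * a)^-1) => // v.
rewrite -addrA (addrC v) addrA !sqr_enorm !dotpE (dotpC v y) (dotpC v z) (dotpC z y).
rewrite le_eqVlt; apply/orP; left; apply/eqP; field; rewrite gt_eqF//.
Qed.

Lemma enorm_le_of_dotp u v : enorm u ^+ 2 <= dotp v u -> enorm u <= enorm v.
Proof.
move=> h; have [->|u0] := eqVneq (enorm u) 0; first exact: enorm_ge0.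
have up : 0 < enorm u by rewrite lt_def u0 enorm_ge0.
by rewrite -(ler_pM2r up) -expr2 (le_trans h)// dotp_le.
Qed.

(** Stated through the inclusions rather than [prox], because the minimizer of [f + r] enters as a
    point satisfying such an inclusion. *)
Lemma resolvent_nonexpansive r (a : R) z1 z2 y1 y2 : 0 < a ->
  subdifferential r y1 (a^-1 *: (z1 - y1)) ->
  subdifferential r y2 (a^-1 *: (z2 - y2)) -> enorm (y1 - y2) <= enorm (z1 - z2).
Proof.
move=> a0 p1 p2; have := subdifferential_monotone p1 p2.
rewrite -scalerBr dotpZl pmulr_rge0 ?invr_gt0// => h.
apply: enorm_le_of_dotp; move: h; rewrite sqr_enorm !dotpE.
by lra.
Qed.

Lemma prox_nonexpansive r (a : R) z1 z2 y1 y2 : 0 < a -> jensen r ->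
  prox a r z1 y1 -> prox a r z2 y2 -> enorm (y1 - y2) <= enorm (z1 - z2).
Proof.
move=> a0 cr /prox_subdifferential p1 /prox_subdifferential p2.
exact: resolvent_nonexpansive (p1 a0 cr) (p2 a0 cr).
Qed.

(** Monotonicity of subgradients between [y] and [x] gives [enorm (y - x) ^+ 2 <= - a * dotp (d + g)
    (y - x)]. *)
Lemma prox_step_le r (a : R) x d y g : 0 < a -> jensen r ->
  prox a r (x - a *: d) y -> subdifferential r x g ->
  enorm (y - x) <= a * (enorm d + enorm g).
Proof.
move=> a0 cr /prox_subdifferential p gx.
have := subdifferential_monotone (p a0 cr) gx.
rewrite -(pmulr_rge0 _ a0) -dotpZl scalerBr scalerA divff ?gt_eqF// scale1r => h.
apply: (@le_trans _ _ (enorm (- a *: (d + g)))).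
  apply: enorm_le_of_dotp; move: h; rewrite sqr_enorm !dotpE.
  by rewrite (dotpC x y); lra.
by rewrite enormZ normrN gtr0_norm// ler_pM2l// ler_enormD.
Qed.

End convex.

Lemma group_sum_jensen (R : realType) (n nG : nat) (g : 'I_nG -> {set 'I_n})
    (r_ : forall i : 'I_nG, 'rV[R]_#|g i| -> R) :
  (forall i, jensen (r_ i)) -> jensen (group_sum r_).
Proof.
move=> cr x y t t01; rewrite /group_sum !mulr_sumr -big_split/=.
apply: ler_sum => i _; have := cr i (subvec (g i) x) (subvec (g i) y) t t01.
apply: le_trans; rewrite le_eqVlt; apply/orP; left; apply/eqP; congr (r_ i _).
by apply/rowP => j; rewrite !mxE.
Qed.

Lemma diff_dotp_grad (R : realType) (n : nat) (h : 'rV[R]_n -> R)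
    (x v : 'rV[R]_n) : differentiable h x -> 'd h x v = dotp (grad h x) v.
Proof.
move=> dh; rewrite [in LHS](row_sum_delta v) linear_sum /dotp.
by apply: eq_bigr => i _; rewrite linearZ /= mxE deriveE// mulrC.
Qed.

(** * Smooth functions: first-order expansion and strong monotonicity of the gradient *)

Section smooth.
Context {R : realType} {n : nat}.
Variables (h : 'rV[R]_n -> R) (L : R).
Hypothesis L0 : 0 <= L.
Hypothesis dh : forall x, differentiable h x.
Hypothesis lip : forall x y, enorm (grad h x - grad h y) <= L * enorm (x - y).

(** Mean value theorem on the segment. The constant [L] instead of [L / 2] is harmless: the uses
    below let [v] tend to 0 or need only some finite constant. *)
Lemma taylor1_le y v : `|h (y + v) - h y - dotp (grad h y) v| <= L * enorm v ^+ 2.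
Proof.
pose phi (t : R) := h (y + t *: v).
have dphi (t : R) : is_derive t 1 phi (dotp (grad h (y + t *: v)) v).
  have d1 : is_diff t (fun s : R => y + s *: v) (fun s : R => s *: v).
    have := @is_diffD _ _ _ (cst y) (fun s : R => s *: v) 0 (fun s : R => s *: v) t
      (is_diff_cst _ _) (is_diff_scalel _ _).
    by rewrite add0r.
  have d2 : is_diff (y + t *: v) h ('d h (y + t *: v)) by exact: DiffDef.
  have d3 := @is_diff_comp _ _ _ _ _ _ _ _ _ d1 d2.
  have d4 : differentiable phi t by case: d3.
  apply: DeriveDef; first exact: diff_derivable.
  rewrite deriveE//.
  have -> : 'd phi t = ('d h (y + t *: v) \o (fun s : R => s *: v)) :> (R -> R).
    by case: d3.
  by rewrite /= scale1r diff_dotp_grad.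
have [|c] := @MVT R phi (fun t => dotp (grad h (y + t *: v)) v) 0 1 ltr01.
- by apply: continuous_subspaceT => t; apply: differentiable_continuous;
    apply/derivable1_diffP; case: (dphi t).
rewrite in_itv/= => /andP[c0 c1]; rewrite /phi scale1r scale0r addr0 subr0 mulr1 => ->.
rewrite -dotpNl -dotpDl (le_trans (norm_dotp_le _ _))// expr2 mulrA.
rewrite ler_wpM2r ?enorm_ge0// (le_trans (lip _ _))// addrAC subrr add0r enormZ.
by rewrite ler_wpM2l// ger0_norm ?(ltW c0)// ler_piMl ?enorm_ge0// (ltW c1).
Qed.

(** The gradient inequality [H] is the limit [t -> 0] of strong convexity; its instances at [(x, y)]
    and [(y, x)] are added. *)
Lemma strongly_convex_monotone mu x y : strongly_convex mu h ->
  mu * enorm (x - y) ^+ 2 <= dotp (grad h x - grad h y) (x - y).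
Proof.
move=> sc.
have H u v : dotp (grad h u) (v - u) <= h v - h u - mu / 2 * enorm (v - u) ^+ 2.
  rewrite -subr_ge0; set N := enorm (v - u) ^+ 2.
  apply: (@ge0_of_quadratic_slope _ _ ((mu / 2 + L) * N)) => t /andP[t0 t1].
  have := sc v u t; rewrite (ltW t0) t1 => /(_ isT).
  have -> : t *: v + (1 - t) *: u = u + t *: (v - u).
    by rewrite scalerBl scale1r scalerBr addrCA addrA.
  have := taylor1_le u (t *: (v - u)).
  rewrite enormZ exprMn real_normK ?num_real// dotpZr ler_norml -/N => /andP[+ _].
  by lra.
have := H x y; have := H y x; rewrite (enormBC y x) -(opprB x y) !dotpE.
by lra.
Qed.

End smooth.

(** * Contraction of one inexact proximal gradient step *)

Section prox_gradient_step.
Context {R : realType} {n : nat}.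
Variables (f r : 'rV[R]_n -> R) (L mu : R).
Hypotheses (L0 : 0 < L) (mu0 : 0 < mu).
Hypothesis df : forall x, differentiable f x.
Hypothesis lip : forall x y, enorm (grad f x - grad f y) <= L * enorm (x - y).
Hypothesis sc : strongly_convex mu f.
Hypothesis cr : jensen r.
Let a := mu / L ^+ 2.
Let kappa := mu ^+ 2 / L ^+ 2.

(** The minimizer is a fixed point of the exact step, so nonexpansiveness leaves only the forward
    step to compare. With this [a] both [a * mu] and [a ^+ 2 * L ^+ 2] equal [kappa], hence its
    exact part contracts by [1 - kappa]. Young's inequality with weight [kappa / 2] splits off the
    gradient error and costs half of that gain. *)
Lemma inexact_prox_gradient_contraction xs x d y :
  argmin (fun z => f z + r z) xs -> prox a r (x - a *: d) y ->
  enorm (y - xs) ^+ 2 <= (1 - kappa / 2) * enorm (x - xs) ^+ 2 +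
    (1 + 2 / kappa) * a ^+ 2 * enorm (d - grad f x) ^+ 2.
Proof.
move=> mxs py.
have a0 : 0 < a by rewrite divr_gt0// exprn_gt0.
have k0 : 0 < kappa by rewrite divr_gt0// exprn_gt0.
have sxs : subdifferential r xs (- grad f xs).
  apply: (@argmin_subdifferential _ _ f r xs _ L) => // v.
  have := taylor1_le (ltW L0) df lip xs v.
  by rewrite ler_norml => /andP[_]; lra.
have sxs' : subdifferential r xs (a^-1 *: ((xs - a *: grad f xs) - xs)).
  by rewrite addrAC subrr add0r scalerN scalerA mulVf ?gt_eqF// scale1r.
have := resolvent_nonexpansive a0 (prox_subdifferential a0 cr py) sxs'.
have -> : x - a *: d - (xs - a *: grad f xs) =
    ((x - xs) - a *: (grad f x - grad f xs)) + (- a) *: (d - grad f x).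
  by apply/rowP => i; rewrite !mxE; ring.
set u := x - xs - a *: (grad f x - grad f xs) => h.
have : enorm (y - xs) ^+ 2 <= enorm (u + - a *: (d - grad f x)) ^+ 2.
  by rewrite ler_pXn2r// nnegrE enorm_ge0.
move=> /le_trans; apply.
have q0 : 0 < kappa / 2 by rewrite divr_gt0.
apply: (le_trans (sqr_enormD_le _ _ q0)).
rewrite enormZ normrN gtr0_norm// exprMn invf_div [X in _ + X <= _]mulrA lerD2r.
have hu : enorm u ^+ 2 <= (1 - kappa) * enorm (x - xs) ^+ 2.
  rewrite {1}sqr_enorm /u; set w := x - xs; set g := grad f x - grad f xs.
  have m : mu * enorm w ^+ 2 <= dotp g w := strongly_convex_monotone (ltW L0) df lip x xs sc.
  have l : dotp g g <= L ^+ 2 * enorm w ^+ 2.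
    rewrite -sqr_enorm -exprMn ler_pXn2r// ?nnegrE ?mulr_ge0 ?enorm_ge0 ?(ltW L0)//.
    exact: lip.
  move: m l; clearbody w g => m l; rewrite !dotpE (dotpC w g) -sqr_enorm.
  have e1 : a * (a * L ^+ 2) = kappa by rewrite /a /kappa; field; rewrite gt_eqF.
  have e2 : a * mu = kappa by rewrite /a /kappa; field; rewrite gt_eqF.
  have := ler_wpM2l (ltW a0) m; rewrite mulrA e2.
  have := ler_wpM2l (ltW a0) (ler_wpM2l (ltW a0) l).
  have -> : a * (a * (L ^+ 2 * enorm w ^+ 2)) = kappa * enorm w ^+ 2.
    by rewrite -e1; ring.
  by lra.
apply: (le_trans (ler_wpM2l _ hu)); first by rewrite addr_ge0// ltW.
rewrite mulrA ler_wpM2r ?sqr_ge0//.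
by have := sqr_ge0 kappa; nra.
Qed.

Lemma relaxed_step_recursion xs x d y (b : R) :
  argmin (fun z => f z + r z) xs -> prox a r (x - a *: d) y -> 0 <= b <= 1 ->
  enorm (x + b *: (y - x) - xs) ^+ 2 <=
    (1 - b * (kappa / 2)) * enorm (x - xs) ^+ 2 +
    b * ((1 + 2 / kappa) * a ^+ 2 * enorm (d - grad f x) ^+ 2).
Proof.
move=> mxs py b01.
have -> : x + b *: (y - x) - xs = (1 - b) *: (x - xs) + b *: (y - xs).
  by apply/rowP => i; rewrite !mxE; ring.
apply: (le_trans (sqr_enorm_convex _ _ b01)).
have := inexact_prox_gradient_contraction mxs py; case/andP: b01 => b0 b1.
by move=> /(ler_wpM2l b0); lra.
Qed.

End prox_gradient_step.

(** * Polynomial decay from the scalar recursion *)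

Section decay.
Context {R : realType}.

(** With [u = expR v], factor the power as [expR v * expR ((theta - 1) * v)] and bound the second
    factor below by its tangent; then [expR v * (1 - v) <= 1] bounds [v * expR v] below by
    [u - 1]. *)
Lemma bernoulli_powR (u theta : R) : 0 < u -> 1 <= theta ->
  1 + theta * (u - 1) <= u `^ theta.
Proof.
move=> u0 t1; rewrite /powR (gt_eqF u0).
have -> : u = expR (ln u) by rewrite lnK// posrE.
rewrite expRK; set v := ln u.
have -> : theta * v = v + (theta - 1) * v by ring.
rewrite expRD.
have := ler_wpM2l (expR_ge0 v) (expR_ge1Dx ((theta - 1) * v)).
have : expR v * (1 - v) <= 1.
  rewrite -[leRHS](expRxMexpNx_1 v) ler_wpM2l ?expR_ge0//.
  exact: expR_ge1Dx.
set e := expR v => h.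
have : (theta - 1) * (e * (1 - v)) <= (theta - 1) * 1 by rewrite ler_wpM2l// subr_ge0.
by lra.
Qed.

(** Bernoulli at [k / (k + 1)] bounds the contraction factor by a ratio of consecutive powers, so
    the first term propagates. The noise terms add up to [K * l] times [1 / (k + 1) - (theta - 2) /
    (k * (k + 1))], which is where [2 <= theta] enters. *)
Lemma polynomial_decay (D : nat -> R) (theta K eta : R) (k0 : nat) :
  (0 < k0)%N -> 2 <= theta -> 0 <= K -> 0 < eta < 2 -> (forall k, 0 <= D k) ->
  (forall k, (k0 <= k)%N -> D k.+1 <= (1 - theta / k.+1%:R) * D k +
     K * (ln (2 * k%:R / eta) / (k%:R * k.+1%:R))) ->
  forall k, (k0 <= k)%N ->
  D k <= (k0 + 2)%:R `^ theta * (D k0 / k%:R `^ theta) + K * (ln (2 * k%:R / eta) / k%:R).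
Proof.
move=> k00 th2 K0 /andP[e0 e2] D0 rec.
have lnk k : (0 < k)%N -> 0 <= ln (2 * k%:R / eta).
  move=> kk; apply: ln_ge0; rewrite ler_pdivlMr// mul1r (le_trans (ltW e2))//.
  by rewrite ler_peMr// ler1n.
have th0 : 0 <= theta by lra.
have B0 : 0 <= (k0 + 2)%:R `^ theta * D k0 by rewrite mulr_ge0 ?powR_ge0.
elim=> [|k IH]; first by rewrite leqn0 => /eqP k00'; rewrite k00' in k00.
rewrite leq_eqVlt => /orP[/eqP <-|].
  have k0R : 0 < k0%:R :> R by rewrite ltr0n.
  have p0 : 0 < k0%:R `^ theta by rewrite powR_gt0.
  have h : D k0 <= (k0 + 2)%:R `^ theta * (D k0 / k0%:R `^ theta).
    rewrite [leRHS]mulrA ler_pdivlMr// mulrC ler_wpM2r//.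
    by rewrite ge0_ler_powR ?nnegrE// ler_nat leq_addr.
  by rewrite (le_trans h)// lerDl mulr_ge0// divr_ge0// lnk.
rewrite ltnS => k0k; have kk : (0 < k)%N := leq_trans k00 k0k.
apply: (le_trans (rec _ k0k)).
have kR : 0 < k%:R :> R by rewrite ltr0n.
have kSR : 0 < k.+1%:R :> R by rewrite ltr0n.
have pk : 0 < k%:R `^ theta by rewrite powR_gt0.
have pkS : 0 < k.+1%:R `^ theta by rewrite powR_gt0.
have lnS : ln (2 * k%:R / eta) <= ln (2 * k.+1%:R / eta).
  rewrite ler_ln ?posrE ?divr_gt0 ?mulr_gt0//.
  by rewrite ler_pM2r ?invr_gt0// ler_pM2l// ler_nat.
set l := ln (2 * k%:R / eta) in lnS IH *; have l0 : 0 <= l by exact: lnk.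
set B := (k0 + 2)%:R `^ theta in IH B0 *.
have hl : K * (l / k.+1%:R) <= K * (ln (2 * k.+1%:R / eta) / k.+1%:R).
  by rewrite ler_wpM2l// ler_wpM2r// invr_ge0 ltW.
(* For [k + 1 <= theta] the induction hypothesis cannot be multiplied by the factor, which is not
   positive; the first term is dropped instead. *)
have [th|th] := lerP (1 - theta / k.+1%:R) 0.
  apply: (@le_trans _ _ (0 + K * (l / k.+1%:R))).
    apply: lerD; first by rewrite mulr_le0_ge0.
    rewrite ler_wpM2l// ler_wpM2l// lef_pV2 ?posrE ?mulr_gt0//.
    by rewrite ler_peMl ?(ltW kSR)// ler1n.
  by rewrite lerD// mulrA divr_ge0// ltW.
apply: (le_trans (lerD (ler_wpM2l (ltW th) (IH k0k)) (lexx _))).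
have h1 : (1 - theta / k.+1%:R) * (B * (D k0 / k%:R `^ theta)) <=
    B * (D k0 / k.+1%:R `^ theta).
  have h0 : 1 - theta / k.+1%:R <= k%:R `^ theta / k.+1%:R `^ theta.
    have <- : (k%:R / k.+1%:R) `^ theta = k%:R `^ theta / k.+1%:R `^ theta.
      by rewrite powRM ?invr_ge0// -powR_inv1// -powRrM mulN1r powRN.
    apply: le_trans (bernoulli_powR _ _); [|by rewrite divr_gt0|by lra].
    by rewrite le_eqVlt; apply/orP; left; apply/eqP; rewrite -natr1; field;
      rewrite natr1 gt_eqF.
  have BD : 0 <= B * (D k0 / k%:R `^ theta) by rewrite mulrA divr_ge0// ltW.
  apply: (le_trans (ler_wpM2r BD h0)).
  by rewrite le_eqVlt; apply/orP; left; apply/eqP; field; rewrite !gt_eqF.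
have h2 : (1 - theta / k.+1%:R) * (K * (l / k%:R)) + K * (l / (k%:R * k.+1%:R)) <=
    K * (l / k.+1%:R).
  have -> : (1 - theta / k.+1%:R) * (K * (l / k%:R)) + K * (l / (k%:R * k.+1%:R)) =
    K * (l / k.+1%:R) - (theta - 2) * (K * l / (k%:R * k.+1%:R)).
    by rewrite -natr1; field; rewrite natr1 !gt_eqF.
  by rewrite gerBl mulr_ge0 ?subr_ge0// divr_ge0 ?mulr_ge0.
by rewrite mulrDr -addrA lerD// (le_trans h2).
Qed.

End decay.

(** * Measurability and independence *)

Section Rvec_measurability.
Context {d : measure_display} {T : measurableType d} {R : realType} {n : nat}.

Lemma measurable_coord (X : T -> Rvec R n) (i : 'I_n) :
  measurable_fun setT X -> measurable_fun setT (fun w => X w 0 i).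
Proof.
move=> mX; have mc : measurable_fun [set: Rvec R n] (fun x : Rvec R n => x 0 i).
  apply: (measurability _ (RGenOpens.measurableE R)) => _ [_ [a [b ->]] <-].
  rewrite setTI; apply: sub_sigma_algebra.
  by apply: open_comp; [move=> x _; exact: coord_continuous|exact: interval_open].
exact: measurableT_comp mc mX.
Qed.

(** An open set is a countable union of sup-norm balls with rational centres and radii
    [1 / (k + 1)], and such a ball is a finite intersection of conditions on single coordinates. *)
Lemma measurable_Rvec (X : T -> Rvec R n) :
  (forall i, measurable_fun setT (fun w => X w 0 i)) -> measurable_fun setT X.
Proof.
move=> mX; apply: (@measurability _ _ T (Rvec R n) setT X (@open 'rV[R]_n)) => // _ [U oU <-].
rewrite setTI.
pose Q : Type := ('rV[rat]_n * nat)%type.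
pose q2 (q : Q) : 'rV[R]_n := map_mx ratr q.1.
pose B (q : Q) : set 'rV[R]_n := ball (q2 q) q.2.+1%:R^-1.
(* Balls not contained in [U] contribute the empty set, so that the union runs over a whole
   countable type. *)
have -> : X @^-1` U = \bigcup_(q : Q)
    (if pselect (B q `<=` U) then X @^-1` B q else set0).
  apply/seteqP; split => [w Uw|w [q _]]; last by case: pselect => // h /h.
  have /nbhs_ballP[e /= e0 eU] := open_nbhs_nbhs (conj oU Uw).
  have [k ke] : exists k : nat, k.+1%:R^-1 < e / 2.
    have /= := @near_infty_natSinv_lt R (PosNum (divr_gt0 e0 (ltr0Sn _ 1))).
    by move=> [k _ /(_ k (leqnn _))] h; exists k.
  have k0 : 0 < k.+1%:R^-1 :> R by rewrite invr_gt0.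
  have /choice[s hs] (i : 'I_n) : exists q : rat, `|ratr q - X w 0 i| < k.+1%:R^-1.
    have /rat_in_itvoo[q] : X w 0 i - k.+1%:R^-1 < X w 0 i + k.+1%:R^-1.
      by rewrite ltrBlDr -addrA ltrDl addr_gt0.
    by rewrite in_itv/= => h; exists q; rewrite ltr_distl.
  exists ((\row_i s i, k) : Q) => //.
  case: pselect => [h|[]].
    split => // j i; rewrite [j]ord1 /= !mxE; exact: hs.
  move=> z [_ zB]; apply: eU; split=> // j i; rewrite [j]ord1.
  have := zB 0 i; rewrite /ball/= !mxE => hz.
  rewrite (le_lt_trans (ler_distD (ratr (s i)) _ _))// (splitr e) ltrD//.
    by rewrite distrC (lt_trans (hs i)).
  exact: lt_trans hz ke.
apply: countable_bigcupT_measurable => [|q]; first exact: countableP.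
case: pselect => Bq /=; last exact: measurable0.
have -> : X @^-1` B q = \bigcap_(i in [set: 'I_n])
    [set w | `|q2 q 0 i - X w 0 i| < q.2.+1%:R^-1].
  apply/seteqP; split => [w [_ h] i _|w h]; first exact: h.
  by split => [|j i]; [rewrite invr_gt0|rewrite [j]ord1; exact: h].
apply: fin_bigcap_measurable => [|i _]; first exact: finite_finset.
have mf : measurable_fun setT (fun w => `|q2 q 0 i - X w 0 i|).
  by apply: measurableT_comp => //; apply: measurable_funB.
have := mf measurableT `]-oo, q.2.+1%:R^-1[%classic (measurable_itv _).
rewrite setTI [X in measurable X -> _](_ : _ = [set w | `|q2 q 0 i - X w 0 i| < q.2.+1%:R^-1])//.
Qed.

Lemma enorm_lt_open (c : 'rV[R]_n) (e : R) : open [set z | enorm (z - c) < e].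
Proof.
have -> : [set z : 'rV[R]_n | enorm (z - c) < e] =
    (fun z => enorm (z - c)) @^-1` [set t | t < e] by [].
apply: open_comp => [z _|]; last exact: open_lt.
apply: (@continuous_comp _ _ _ (fun z : 'rV[R]_n => dotp (z - c) (z - c)) Num.sqrt);
  last exact: sqrt_continuous.
have ct : continuous (fun z : 'rV[R]_n => \sum_(i < n) (z - c) 0 i * (z - c) 0 i).
  apply: continuous_big => [|i _]; first exact: add_continuous.
  have cz : continuous (fun z : 'rV[R]_n => (z - c) 0 i).
    under eq_fun do rewrite !mxE.
    by move=> z'; apply: continuousB; [exact: coord_continuous|exact: cst_continuous].
  by move=> z'; apply: continuousM; exact: cz.
exact: ct.
Qed.

(** [Y] is not given as a function of [Z]: this is how a point selected from [prox] becomes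
    measurable. The sublevel set is the preimage of a union of balls, possibly uncountable but
    open. *)
Lemma measurable_lipschitz_factor (Z : T -> Rvec R n) (Y : T -> R) (L : R) :
  0 < L -> measurable_fun setT Z ->
  (forall w w', `|Y w - Y w'| <= L * enorm (Z w - Z w' : 'rV[R]_n)) ->
  measurable_fun setT Y.
Proof.
move=> L0 mZ YZ; apply: (measurability _ (RGenInftyO.measurableE R)).
move=> _ [_ [a ->] <-]; rewrite setTI.
pose U := \bigcup_(w' in [set w' | Y w' < a])
  [set z : 'rV[R]_n | enorm (z - Z w') < (a - Y w') / L].
have -> : Y @^-1` `]-oo, a[%classic = Z @^-1` (U : set (Rvec R n)).
  apply/seteqP; split=> w /=.
    rewrite in_itv/= => Ya; exists w => //=.
    by rewrite subrr enorm0 divr_gt0// subr_gt0.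
  move=> [w' /= Ya]; rewrite ltr_pdivlMr// mulrC => h; rewrite in_itv/=.
  have := YZ w w'; rewrite ler_norml => /andP[_]; lra.
rewrite -[X in measurable X]setTI; apply: mZ => //.
apply: sub_sigma_algebra; apply: bigcup_open => w' _; exact: enorm_lt_open.
Qed.

Lemma measurable_enorm (X : T -> Rvec R n) :
  measurable_fun setT X -> measurable_fun setT (fun w => enorm (X w : 'rV[R]_n)).
Proof.
move=> mX; apply: (@measurable_lipschitz_factor X _ 1) => // w w'.
by rewrite mul1r ler_dist_enorm.
Qed.

End Rvec_measurability.

(** * Integrating out an independent variable *)

Section freezing.
Local Open Scope ereal_scope.
Context {d d1 d2 : measure_display} {T : measurableType d}
  {T1 : measurableType d1} {T2 : measurableType d2} {R : realType}.
Variables (P : probability T R) (Q : probability T2 R).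
Variables (V : {RV P >-> T1}) (X : {RV P >-> T2}).
Hypothesis XQ : forall B, measurable B -> distribution P X B = Q B.
Hypothesis VX : forall A B, measurable A -> measurable B ->
  P (V @^-1` A `&` X @^-1` B) = P (V @^-1` A) * P (X @^-1` B).

(** By independence the law of [(V, X)] is the product of the law of [V] with [Q], so Fubini
    integrates over [X] first for each fixed value of [V]. *)
Lemma freezing_integral_eq0 (Phi : T1 * T2 -> R) : measurable_fun setT Phi ->
  P.-integrable setT (fun w => (Phi (V w, X w))%:E) ->
  (forall v, \int[Q]_s (Phi (v, s))%:E = 0) ->
  \int[P]_w (Phi (V w, X w))%:E = 0.
Proof.
move=> mPhi iPhi Phi0.
have mW : measurable_fun setT (fun w => (V w, X w)) by exact: measurable_fun_pair.
pose W : {RV P >-> (T1 * T2)%type} := mfun_Sub (mem_set mW).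
have prodE A : measurable A -> (distribution P V \x Q) A = distribution P W A.
  apply: product_measure_unique => {}A B mA mB /=.
  rewrite -[RHS](_ : distribution P V A * distribution P X B = _); last by rewrite XQ.
  by rewrite -VX.
have iD : (distribution P W).-integrable setT (EFin \o Phi).
  apply: integrable_pushforward => //.
  exact/measurable_EFinP.
have iQ : (distribution P V \x Q).-integrable setT (EFin \o Phi).
  apply/integrableP; split; first by case/integrableP: iD.
  rewrite (eq_measure_integral (distribution P W)); first by case/integrableP: iD.
  by move=> A mA _; exact: prodE.
transitivity (\int[distribution P W]_z (EFin \o Phi) z).
  by rewrite integral_distribution//; exact/measurable_EFinP.
transitivity (\int[distribution P V \x Q]_z (EFin \o Phi) z).
  by apply: eq_measure_integral => A mA _; apply/esym/prodE.
rewrite -integral12_prod_meas1//; apply: integral0_eq => v _; exact: Phi0.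
Qed.

End freezing.

(** * Independence of a sample from the past *)

Section sample_independence.
Local Open Scope ereal_scope.
Context {d : measure_display} {T : measurableType d} {R : realType}
  {P : probability T R} {p m : nat} {Pxi : probability (Rvec R p) R}
  {xi : nat -> 'I_m -> {RV P >-> Rvec R p}}.
Hypothesis hxi : iid_samples Pxi xi.

(** Generators only. There are none for [k <= 1], so the trivial sigma-algebra at the deterministic
    start needs no separate case. *)
Definition past_events (k : nat) : set (set T) :=
  \bigcup_(j in [set j | (1 <= j < k)%N]) \bigcup_(i in [set: 'I_m])
    preimage_set_system [set: T] (xi j i) measurable.

Lemma past_events_measurable k : past_events k `<=` measurable.
Proof.
move=> A [j _ [i _ [B mB <-]]]; exact: (measurable_funPT (xi j i)).
Qed.

Lemma sigma_past_measurable k : <<s past_events k>> `<=` measurable.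
Proof.
by apply: smallest_sub => //; [exact: sigma_algebra_measurable|exact: past_events_measurable].
Qed.

Lemma past_eventsS k : past_events k `<=` past_events k.+1.
Proof.
move=> A [j /= /andP[j1 jk] h]; exists j => //=; rewrite j1/= ltnS; exact: ltnW.
Qed.

(** Finite cylinders in the past samples form a pi-system generating the past. By mutual
    independence [P] restricted to [C] and [P] scaled by [P C] agree on it, hence on the generated
    sigma-algebra. *)
Lemma sample_independent_of_past k i : (1 <= k)%N ->
  independent_of P <<s past_events k>> (xi k i).
Proof.
move=> k1 A B sA mB.
pose J := [seq (j, i') | j <- iota 1 k.-1, i' <- enum 'I_m].
have JP j i' : ((j, i') \in J) = (1 <= j < k)%N.
  apply/allpairsP/idP => [[[a b] /= [ha _ [-> _]]]|jk].
    by move: ha; rewrite mem_iota; case: (k) k1 => // k'.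
  exists (j, i') => /=; split => //; last by rewrite mem_enum.
  by rewrite mem_iota; case: (k) k1 jk.
have uJ : uniq J.
  apply: allpairs_uniq; [exact: iota_uniq|exact: enum_uniq|].
  by move=> [a b] [a' b'] _ _ /= [-> ->].
pose cyl (D : nat * 'I_m -> set (Rvec R p)) : set T :=
  \bigcap_(ji in [set` J]) (xi ji.1 ji.2 @^-1` D ji).
pose G : set (set T) := [set S | exists D, (forall ji, measurable (D ji)) /\ S = cyl D].
pose C := xi k i @^-1` B.
have mC : measurable C by exact: measurable_funPTI.
have GI : setI_closed G.
  move=> _ _ [D [mD ->]] [D' [mD' ->]]; exists (fun ji => D ji `&` D' ji); split.
    by move=> ji; exact: measurableI.
  by rewrite /cyl -bigcapI; apply: eq_bigcapr => ji _; rewrite preimage_setI.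
have Gm : G `<=` measurable.
  move=> _ [D [mD ->]]; apply: fin_bigcap_measurable => [|ji _].
    exact: finite_seq.
  exact: measurable_funPTI.
have Gprod S : G S -> P (S `&` C) = P S * P C.
  move=> [D [mD ->]].
  have h1 : P (cyl D) = (\prod_(j <- J) fine (P (xi j.1 j.2 @^-1` D j)))%:E.
    apply: hxi.2 => // -[j i'] /=; rewrite JP => /andP[]//.
  (* The new sample joins the cylinder as one more index; [(k, i)] is not in [J], so the old sets
     are unchanged. *)
  pose D' ji := if ji == (k, i) then B else D ji.
  have kJ : (k, i) \notin J by rewrite JP ltnn andbF.
  have D'D ji : ji \in J -> D' ji = D ji.
    move=> jJ; rewrite /D'; case: eqP => // e; by rewrite -e jJ in kJ.
  have : P (\bigcap_(ji in [set` (k, i) :: J]) (xi ji.1 ji.2 @^-1` D' ji)) =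
     (\prod_(j <- (k, i) :: J) fine (P (xi j.1 j.2 @^-1` D' j)))%:E.
    apply: hxi.2; first by rewrite /= kJ.
      move=> [j i'] /=; rewrite inE => /orP[/eqP[-> _]//|]; rewrite JP => /andP[]//.
    by move=> ji; rewrite /D'; case: ifP.
  have -> : [set` (k, i) :: J] = (k, i) |` [set` J].
    rewrite predeqE => ji /=; rewrite in_cons; split => [/orP[/eqP|]|[->|->]];
      by [left|right|rewrite eqxx|rewrite orbT].
  rewrite bigcap_setU1 big_cons /= {1 3}/D' eqxx.
  rewrite (eq_bigcapr (G := fun ji => xi ji.1 ji.2 @^-1` D ji)); last first.
    by move=> ji /= jJ; rewrite D'D.
  rewrite big_seq (eq_bigr (fun ji => fine (P (xi ji.1 ji.2 @^-1` D ji)))); last first.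
    by move=> ji jJ; rewrite D'D.
  rewrite -big_seq EFinM -h1 fineK ?fin_num_measure// => h.
  by rewrite setIC muleC.
have pC : (0 <= fine (P C))%R by exact: fine_ge0.
pose m1 : {measure set T -> \bar R} := mrestr P mC.
pose m2 : {measure set T -> \bar R} := mscale (NngNum pC) P.
have m2E S : m2 S = P S * P C by rewrite /m2/= /mscale/= fineK ?fin_num_measure// muleC.
have GE : [set X | G X /\ X `<=` [set: T]] = G.
  by apply/seteqP; split => [S []//|S GS]; split.
have sAG : <<s G>> A.
  apply: (smallest_sub _ _ sA); first exact: smallest_sigma_algebra.
  move=> S [j /= jk [i' _ [B' mB' <-]]]; apply: sub_sigma_algebra.
  exists (fun ji => if ji == (j, i') then B' else setT); split.
    by move=> ji; case: ifP.
  rewrite setTI; apply/seteqP; split => [w Bw ji _|w /(_ (j, i'))].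
    by rewrite /=; case: eqP => // ->.
  by rewrite /= eqxx; apply; rewrite JP.
have := @g_sigma_algebra_measure_unique_trace _ R T G setT measurableT.
rewrite GE => /(_ Gm GI m1 m2) h.
rewrite -m2E; apply: h => //.
- by rewrite m2E /m1/= /mrestr setTI probability_setT mul1e.
- by move=> S GS; rewrite m2E -Gprod.
- by rewrite /m1/= /mrestr (le_lt_trans (probability_le1 _ _)) ?ltry//; exact: measurableI.
Qed.

End sample_independence.

(** * Integrals under almost sure bounds *)

Section ae_integration.
Context {d : measure_display} {T : measurableType d} {R : realType}.
Variable P : probability T R.

Lemma ae_dominated_integrable (f g : T -> R) : measurable_fun setT f ->
  P.-integrable setT (EFin \o g) -> {ae P, forall w, `|f w| <= g w} ->
  P.-integrable setT (EFin \o f).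
Proof.
move=> mf ig fg; apply/integrableP; split; first exact/measurable_EFinP.
have mg : measurable_fun setT g by apply/measurable_EFinP; case/integrableP: ig.
case/integrableP: ig => _; apply: le_lt_trans.
apply: ae_ge0_le_integral => //=.
- by apply/measurable_EFinP; apply: measurableT_comp.
- by apply/measurable_EFinP; apply: measurableT_comp.
- by apply: filterS fg => w h _; rewrite lee_fin (le_trans h)// ler_norm.
Qed.

Lemma ae_bounded_integrable (f : T -> R) (c : R) : measurable_fun setT f ->
  {ae P, forall w, `|f w| <= c} -> P.-integrable setT (EFin \o f).
Proof.
move=> mf fc; apply: (ae_dominated_integrable mf _ fc).
by apply/finite_measure_integrable_cst.
Qed.

Lemma ae_le_Rintegral (f g : T -> R) :
  P.-integrable setT (EFin \o f) -> P.-integrable setT (EFin \o g) ->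
  {ae P, forall w, f w <= g w} -> \int[P]_w f w <= \int[P]_w g w.
Proof.
move=> jf jg fg; rewrite -subr_ge0 -RintegralB//.
have mf : measurable_fun setT f by apply/measurable_EFinP; case/integrableP: jf.
have mg : measurable_fun setT g by apply/measurable_EFinP; case/integrableP: jg.
rewrite /Rintegral (ae_eq_integral (fun w => `|g w - f w|%:E)) //.
- by apply: fine_ge0; apply: integral_ge0 => w _; rewrite lee_fin.
- by apply/measurable_EFinP; apply: measurable_funB.
- by apply/measurable_EFinP; apply: measurableT_comp => //; apply: measurable_funB.
- by apply: filterS fg => w h _; rewrite ger0_norm// subr_ge0.
Qed.

Lemma Rintegral_cstT (c : R) : \int[P]_w c = c.
Proof.
have P1 : fine (P setT) = 1 by rewrite probability_setT.
by rewrite Rintegral_cst// [X in _ * X]P1 mulr1.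
Qed.

Lemma ae_bounded_Rintegral (f : T -> R) (c : R) : measurable_fun setT f ->
  {ae P, forall w, `|f w| <= c} -> `|\int[P]_w f w| <= c.
Proof.
move=> mf fc; have jf := ae_bounded_integrable mf fc.
have jc (a : R) : P.-integrable setT (EFin \o cst a) by exact/finite_measure_integrable_cst.
rewrite ler_norml -{1}(Rintegral_cstT (- c)) -{2}(Rintegral_cstT c).
apply/andP; split; apply: ae_le_Rintegral; [exact: jc|exact: jf| |exact: jf|exact: jc|].
  by apply: filterS fc => w; rewrite ler_norml => /andP[].
by apply: filterS fc => w; rewrite ler_norml => /andP[].
Qed.

(** Testing the conditional probability on the whole space already gives [P A = 1]. *)
Lemma cond_prob1_ae (G : set (set T)) (A : set T) : G setT ->
  is_cond_prob P G A (cst 1) -> {ae P, forall w, A w}.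
Proof.
move=> GT [/integrableP[m1A _] _ _ /(_ _ GT)].
have mA : measurable A by apply/(measurable_indicP R)/measurable_EFinP.
rewrite integral_indic// setIT => PA.
have PA1 : P A = 1%E.
  rewrite PA (eq_integral (cst 1%E))//.
  have PT : P setT = 1%E by exact: probability_setT.
  by rewrite integral_cst// [X in (_ * X)%E]PT mule1.
exists (~` A); split; [exact: measurableC| |by move=> w /=].
by rewrite probability_setC// PA1 subee.
Qed.

End ae_integration.

(** * Unbiasedness of the stochastic gradient at a fixed point *)

Section expected_gradient.
Context {R : realType} {n p : nat}.
Variables (Pxi : probability (Rvec R p) R) (l : 'rV[R]_n -> Rvec R p -> R) (Lg : R).
Hypotheses (hl : stochastic_loss Pxi l) (Lg0 : 0 <= Lg).
Hypothesis hLip : lipschitz_gradients Lg Pxi l.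
Let f := expected_loss Pxi l.

Lemma expected_lossE x : f x = \int[Pxi]_s l x s.
Proof. by rewrite /f /expected_loss unlock. Qed.

Lemma measurable_gradl x i : measurable_fun setT (fun s : Rvec R p => gradl l x s 0 i).
Proof.
have [_ mg _] := hl.
apply: (@measurableT_comp _ _ _ _ _ _
  (fun z : Rvec R n * Rvec R p => gradl l z.1 z.2 0 i) _
  (fun s : Rvec R p => (x : Rvec R n, s))) => //.
by apply: measurable_fun_pair.
Qed.

Lemma gradl_taylor_ae x i (t : R) : {ae Pxi, forall s,
  `|l (x + t *: delta_mx 0 i) s - l x s - t * gradl l x s 0 i| <= Lg * t ^+ 2}.
Proof.
have [_ _ dl] := hl; have [lip _ _] := hLip.
apply: filterS dl => s [ds _].
have := taylor1_le Lg0 ds (lip s ds) x (t *: delta_mx 0 i).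
by rewrite dotpZr dotp_delta enormZ enorm_delta mulr1 real_normK ?num_real.
Qed.

(** By the expansion with unit step, a partial derivative differs from a difference of two
    integrable losses by at most [Lg]. *)
Lemma integrable_gradl x i : Pxi.-integrable setT (EFin \o (fun s => gradl l x s 0 i)).
Proof.
have [il _ _] := hl.
apply: (@ae_dominated_integrable _ _ _ _ _
  (fun s => `|l (x + 1 *: delta_mx 0 i) s| + (`|l x s| + Lg))).
- exact: measurable_gradl.
- have ia y : Pxi.-integrable setT (EFin \o (fun s => `|l y s|)).
    by have := integrable_abse (il y).
  have -> : EFin \o (fun s => `|l (x + 1 *: delta_mx 0 i) s| + (`|l x s| + Lg)) =
    (EFin \o (fun s => `|l (x + 1 *: delta_mx 0 i) s|)) \+
    ((EFin \o (fun s => `|l x s|)) \+ (EFin \o cst Lg)) by [].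
  apply: integrableD => //; apply: integrableD => //.
  exact/finite_measure_integrable_cst.
- apply: filterS (gradl_taylor_ae x i 1) => s.
  rewrite expr1n mulr1 mul1r => h.
  set a := l (x + _) s in h *; set b := l x s in h *; set g := gradl _ _ _ _ _ in h *.
  have := ler_norm a; have := ler_norm (- a); have := ler_norm b; have := ler_norm (- b).
  rewrite !normrN; move: h; rewrite !ler_norml => /andP[h1 h2] h3 h4 h5 h6.
  by apply/andP; split; lra.
Qed.

(** Both [t * G] and [t * D] approximate [f y - f x] up to [Lg * t ^+ 2], so [G] and [D] agree as
    [t] tends to 0. *)
Lemma expected_gradl x i : \int[Pxi]_s gradl l x s 0 i = grad f x 0 i.
Proof.
have [il _ _] := hl; have [_ df lipf] := hLip.
set G := \int[Pxi]_s _; set D := grad f x 0 i.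
have H (t : R) : 0 < t <= 1 -> `|t * (G - D)| <= 2 * Lg * t ^+ 2.
  move=> _; set y := x + t *: delta_mx 0 i.
  have h1 : `|f y - f x - t * D| <= Lg * t ^+ 2.
    have := taylor1_le Lg0 df lipf x (t *: delta_mx 0 i).
    by rewrite dotpZr dotp_delta enormZ enorm_delta mulr1 real_normK ?num_real.
  have jg : Pxi.-integrable setT (EFin \o (fun s => t * gradl l x s 0 i)).
    by have := integrableZl measurableT t (integrable_gradl x i).
  have jl : Pxi.-integrable setT (EFin \o (fun s => l y s - l x s)).
    by have := integrableB measurableT (il y) (il x).
  have h2 : `|f y - f x - t * G| <= Lg * t ^+ 2.
    rewrite !expected_lossE -RintegralB// -RintegralZl//; last exact: integrable_gradl.
    rewrite -RintegralB//.
    apply: ae_bounded_Rintegral; last exact: gradl_taylor_ae.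
    by apply/measurable_EFinP; case/integrableP: (integrableB measurableT jl jg).
  have -> : t * (G - D) = (f y - f x - t * D) - (f y - f x - t * G) by ring.
  by rewrite (le_trans (ler_normB _ _))// -mulrA mulr2n mulrDl mul1r lerD.
move: G D H => {}G {}D H; apply/eqP; rewrite eq_le.
apply/andP; split; rewrite -subr_ge0; apply: (@ge0_of_quadratic_slope _ _ (2 * Lg)) => t /H;
  rewrite ler_norml => /andP[]; lra.
Qed.

End expected_gradient.

(** * Subgaussian concentration *)

Section exponential_moments.
Context {R : realType}.

(* For [x <= 1/3], [1 + x + x^2] dominates [(1 - x/2)^-2 >= expR x]; for
   [x >= 1/3], already [x <= 3 x^2]. *)
Lemma expR_le_add_expR_sqr (x : R) : expR x <= x + expR (3 * x ^+ 2).
Proof.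
have h := expR_ge1Dx (3 * x ^+ 2).
have [x3|x3] := lerP x (1 / 3); last first.
  have : expR x <= expR (3 * x ^+ 2) by rewrite ler_expR; nra.
  by lra.
have y0 : 0 < 1 - x / 2 by lra.
have hy : 1 - x / 2 <= expR (- (x / 2)) by have := expR_ge1Dx (- (x / 2)); lra.
have e1 : expR x * expR (- (x / 2)) ^+ 2 = 1.
  by rewrite -expRM_natl -expRD -[RHS]expR0; congr expR; field.
have h2 : (1 - x / 2) ^+ 2 <= expR (- (x / 2)) ^+ 2.
  by rewrite ler_pXn2r// nnegrE ?expR_ge0// ltW.
have h3 : expR x * (1 - x / 2) ^+ 2 <= 1 by rewrite -[leRHS]e1 ler_wpM2l// expR_ge0.
have h4 : 1 <= (1 + x + x ^+ 2) * (1 - x / 2) ^+ 2.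
  have : 0 <= x ^+ 2 * (1 - 3 * x + x ^+ 2).
    by rewrite mulr_ge0 ?sqr_ge0//; have := sqr_ge0 x; lra.
  by lra.
have h5 : expR x <= 1 + x + x ^+ 2.
  by rewrite -(ler_pM2r (exprn_gt0 2 y0)) (le_trans h3).
by have := sqr_ge0 x; lra.
Qed.

Context {d : measure_display} {T : measurableType d}.
Variable P : probability T R.

(** Multiply [expR W <= W + expR (3 * W ^+ 2)] by [expR S]: the linear term integrates to zero. *)
Lemma mgf_step (S W : T -> R) (D c : R) :
  measurable_fun setT S -> measurable_fun setT W ->
  {ae P, forall w, `|S w| <= D} -> {ae P, forall w, `|W w| <= c} ->
  \int[P]_w (expR (S w) * W w) = 0 ->
  \int[P]_w expR (S w + W w) <= expR (3 * c ^+ 2) * \int[P]_w expR (S w).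
Proof.
move=> mS mW bS bW h0.
have meS : measurable_fun setT (fun w => expR (S w)) by exact: measurableT_comp.
have ieS : P.-integrable setT (EFin \o (fun w => expR (S w))).
  apply: (@ae_bounded_integrable _ _ _ _ _ (expR D)) => //.
  by apply: filterS bS => w /ler_normlP[_ h]; rewrite ger0_norm ?expR_ge0// ler_expR.
have ieSW : P.-integrable setT (EFin \o (fun w => expR (S w) * W w)).
  apply: (@ae_bounded_integrable _ _ _ _ _ (expR D * c)); first exact: measurable_funM.
  apply: filterS2 bS bW => w hS hW; rewrite normrM ger0_norm ?expR_ge0//.
  apply: ler_pM; rewrite ?expR_ge0// ler_expR.
  by move: hS; rewrite ler_norml => /andP[].
have ie : P.-integrable setT (EFin \o (fun w => expR (S w + W w))).
  apply: (@ae_bounded_integrable _ _ _ _ _ (expR (D + c))).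
    by apply: measurableT_comp => //; exact: measurable_funD.
  apply: filterS2 bS bW => w /ler_normlP[_ hS] /ler_normlP[_ hW].
  by rewrite ger0_norm ?expR_ge0// ler_expR lerD.
have ieS' : P.-integrable setT (EFin \o (fun w => expR (3 * c ^+ 2) * expR (S w))).
  by have := integrableZl measurableT (expR (3 * c ^+ 2)) ieS.
rewrite -RintegralZl// -[leRHS]add0r -h0 -RintegralD//.
apply: ae_le_Rintegral => //.
  by have := integrableD measurableT ieSW ieS'.
apply: filterS bW => w hW; rewrite expRD mulrC.
rewrite [expR (3 * _) * _]mulrC -mulrDr mulrC ler_wpM2l ?expR_ge0//.
rewrite (le_trans (expR_le_add_expR_sqr _))// lerD2l ler_expR ler_pM2l//.
by rewrite -real_normK ?num_real// ler_pXn2r// nnegrE// (le_trans _ hW).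
Qed.

Lemma subgaussian_tail (X : {RV P >-> R}) (D v t : R) : 0 < v -> 0 < t ->
  {ae P, forall w, `|X w| <= D} ->
  (forall lam, \int[P]_w expR (lam * X w) <= expR (3 * lam ^+ 2 * v)) ->
  (P [set w | (t <= `|X w|)%R] <= (2 * expR (- (t ^+ 2 / (12 * v))))%:E)%E.
Proof.
move=> v0 t0 bX mgf.
have tail (s : R) (Y : {RV P >-> R}) : `|s| = 1 -> (Y = (fun w => s * X w) :> (T -> R)) ->
    (P [set w | (t <= Y w)%R] <= (expR (- (t ^+ 2 / (12 * v))))%:E)%E.
  (* Minimizer of the Chernoff exponent [3 * lam ^+ 2 * v - lam * t], with value
     [- (t ^+ 2 / (12 * v))]. *)
  move=> s1 YE; pose lam := t / (6 * v).
  have lam0 : 0 < lam by rewrite divr_gt0// mulr_gt0.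
  apply: (le_trans (chernoff Y t lam0)).
  have -> : mmt_gen_fun P Y lam = (\int[P]_w expR ((lam * s) * X w))%:E.
    rewrite /mmt_gen_fun unlock /Rintegral fineK.
      by apply: eq_integral => w _ /=; rewrite YE; congr ((expR _)%:E); ring.
    apply: integrable_fin_num => //.
    apply: (@ae_bounded_integrable _ _ _ _ (fun w => expR (lam * s * X w)) (expR (lam * D))).
      by apply: measurableT_comp => //; apply: measurable_funM.
    apply: filterS bX => w hX; rewrite ger0_norm ?expR_ge0// ler_expR -mulrA.
    by rewrite ler_pM2l// (le_trans (ler_norm _))// normrM s1 mul1r.
  rewrite -EFinM lee_fin.
  apply: (@le_trans _ _ (expR (3 * (lam * s) ^+ 2 * v) * expR (- (lam * t)))).
    by rewrite ler_wpM2r ?expR_ge0.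
  rewrite -expRD ler_expR.
  have -> : (lam * s) ^+ 2 = lam ^+ 2 by rewrite exprMn -(real_normK (num_real s)) s1 expr1n mulr1.
  by rewrite le_eqVlt; apply/orP; left; apply/eqP; rewrite /lam; field; rewrite gt_eqF.
have mX : measurable_fun setT X by [].
have mXN : measurable_fun setT (fun w => - 1 * X w) by apply: measurable_funM.
have mX1 : measurable_fun setT (fun w => 1 * X w) by apply: measurable_funM.
have h1 := tail 1 (mfun_Sub (mem_set mX1)) (normr1 _) erefl.
have h2 := tail (- 1) (mfun_Sub (mem_set mXN)) (normrN1 _) erefl.
have mle (f : T -> R) : measurable_fun setT f -> measurable [set w | t <= f w].
  move=> mf; have := mf measurableT `[t, +oo[%classic (measurable_itv _).
  by rewrite setTI [X in measurable X -> _](_ : _ = [set w | t <= f w])// predeqE => w /=;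
    rewrite in_itv/= andbT.
have sub : [set w | t <= `|X w|] `<=` [set w | t <= 1 * X w] `|` [set w | t <= - 1 * X w].
  move=> w /=; rewrite mul1r mulN1r; case: (ger0P (X w)) => _ h; [by left|by right].
apply: (le_trans (le_measure P _ _ sub)); rewrite ?inE.
- by apply: mle; apply: measurableT_comp.
- by apply: measurableU; exact: mle.
apply: (le_trans (measureU2 _ (mle _ mX1) (mle _ mXN))).
by rewrite mulr2n mulrDl mul1r EFinD; apply: leeD.
Qed.

End exponential_moments.

(** A supersolution of the variance recursion. Where [b = c / (k + 1)] the claim comes down to
    [(k + 1 - c) ^+ 2 <= k ^+ 2]; where [b = 1 / 2] it follows from [k + 1 <= 2 * c]. *)
Lemma variance_proxy_step (R : realType) (c C : R) (k : nat) (b := Num.min (1 / 2) (c / k.+1%:R)) :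
  2 < c -> (0 < k)%N ->
  (1 - b) ^+ 2 * ((C * c) ^+ 2 / k%:R) + (C * b) ^+ 2 <= (C * c) ^+ 2 / k.+1%:R.
Proof.
move=> c2 k0.
have kR : 1 <= k%:R :> R by rewrite ler1n.
have kS : k.+1%:R = k%:R + 1 :> R by rewrite natr1.
rewrite !exprMn.
suff : (1 - b) ^+ 2 * (c ^+ 2 / k%:R) + b ^+ 2 <= c ^+ 2 / k.+1%:R.
  move=> /(ler_wpM2l (sqr_ge0 C)); move: (b) => b' h.
  apply: (le_trans _ (le_trans h _)); rewrite le_eqVlt; apply/orP; left; apply/eqP; ring.
rewrite {}/b kS; set K := k%:R in kR *.
have K0 : 0 < K by lra.
have [h|h] := lerP (1 / 2) (c / (K + 1)).
  have h' : K + 1 <= 2 * c by move: h; rewrite ler_pdivlMr; lra.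
  rewrite -subr_ge0.
  have -> : c ^+ 2 / (K + 1) - ((1 - 1 / 2) ^+ 2 * (c ^+ 2 / K) + (1 / 2) ^+ 2) =
    ((3 * K - 1) * c ^+ 2 - K * (K + 1)) / (4 * K * (K + 1)).
    by field; rewrite !gt_eqF//; lra.
  have cK : (K + 1) ^+ 2 <= 4 * c ^+ 2 by nra.
  have K1 : 0 <= 3 * K - 1 by lra.
  have KK : 0 <= (3 * K + 1) * (K - 1) * (K + 1) by rewrite !mulr_ge0//; lra.
  rewrite divr_ge0//; first by have := ler_wpM2l K1 cK; lra.
  by rewrite !mulr_ge0//; lra.
rewrite -subr_ge0.
have -> : c ^+ 2 / (K + 1) - ((1 - c / (K + 1)) ^+ 2 * (c ^+ 2 / K) + (c / (K + 1)) ^+ 2) =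
  c ^+ 2 * ((K + 1) * K - (K + 1 - c) ^+ 2 - K) / (K * (K + 1) ^+ 2).
  by field; rewrite !gt_eqF//; lra.
have h' : 2 * c < K + 1 by move: h; rewrite ltr_pdivrMr; lra.
rewrite divr_ge0//; last by rewrite mulr_ge0 ?sqr_ge0//; lra.
by rewrite mulr_ge0 ?sqr_ge0//; nra.
Qed.

(** * The estimation error of the algorithm *)

Lemma past_events_sub (d : measure_display) (T : measurableType d) (R : realType)
    (P : probability T R) (p m : nat) (xi : nat -> 'I_m -> {RV P >-> Rvec R p}) (k : nat)
    (d' : measure_display) (T' : measurableType d') (f : T -> T') :
  measurable_fun [set: g_sigma_algebraType (past_events (xi := xi) k)] f ->
  measurable_fun [set: g_sigma_algebraType (past_events (xi := xi) k.+1)] f.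
Proof.
move=> mf _ B mB; have := mf measurableT B mB; rewrite !setTI.
by apply: sub_sigma_algebra2; exact: past_eventsS.
Qed.

Lemma past_events_measurable_fun (d : measure_display) (T : measurableType d) (R : realType)
    (P : probability T R) (p m : nat) (xi : nat -> 'I_m -> {RV P >-> Rvec R p}) (k : nat)
    (d' : measure_display) (T' : measurableType d') (f : T -> T') :
  measurable_fun [set: g_sigma_algebraType (past_events (xi := xi) k)] f ->
  measurable_fun [set: T] f.
Proof.
move=> mf _ B mB; have := mf measurableT B mB; rewrite !setTI.
exact: sigma_past_measurable.
Qed.

Section storm.
Context {R : realType} {n p m : nat} {d : measure_display} {T : measurableType d}.
Variables (P : probability T R) (Pxi : probability (Rvec R p) R).
Variables (l : 'rV[R]_n -> Rvec R p -> R) (r : 'rV[R]_n -> R).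
Variables (xi : nat -> 'I_m -> {RV P >-> Rvec R p}) (xinit : 'rV[R]_n).
Variables (beta alpha : nat -> R) (x dir y : nat -> T -> 'rV[R]_n).
Variables (Lg Gr sigma Gd zeta a c : R).
Hypothesis hm : (0 < m)%N.
Hypothesis hl : stochastic_loss Pxi l.
Hypothesis hxi : iid_samples Pxi xi.
Hypothesis hrun : S_PStorm r l (fun k i => xi k i : T -> Rvec R p)
  xinit beta alpha zeta x dir y.
Hypothesis cr : jensen r.
Hypothesis Lg0 : 0 < Lg.
Hypothesis hLip : lipschitz_gradients Lg Pxi l.
Hypotheses (Gr0 : 0 < Gr) (sigma0 : 0 < sigma) (Gd0 : 0 < Gd).
Hypothesis hB : oracle_and_iterate_bounds Pxi l r xi x dir Gr sigma Gd.
Hypothesis hbeta : forall k, (1 <= k)%N -> beta k = Num.min (1 / 2) (c / (k.+1)%:R).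
Hypothesis halpha : forall k, (1 <= k)%N -> alpha k = a.
Hypotheses (a0 : 0 < a) (zeta0 : 0 < zeta) (c2 : 2 < c).

Let f := expected_loss Pxi l.

(** Zero at the fictitious index 0: the recursion then covers the first iteration too, and
    inductions start from a trivial case. *)
Definition est_error (k : nat) (w : T) : 'rV[R]_n :=
  if k is 0 then 0 else dir k w - grad f (x k w).

(* [0] at [k = 1], where the recursion for [dir] starts afresh. *)
Definition memory (k : nat) : R := if k == 1%N then 0 else 1 - beta k.

Definition increment (k : nat) (j : 'I_m) (w : T) : 'rV[R]_n :=
  (gradl l (x k w) (xi k j w) - grad f (x k w)) -
  memory k *: (gradl l (x k.-1 w) (xi k j w) - grad f (x k.-1 w)).

Definition noise (k : nat) (w : T) : 'rV[R]_n :=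
  m%:R^-1 *: \sum_(j < m) increment k j w.

Lemma est_error_rec k w :
  est_error k.+1 w = memory k.+1 *: est_error k w + noise k.+1 w.
Proof.
have [[x0 x1] d1 dk _ _] := hrun w.
have m0 : m%:R != 0 :> R by rewrite pnatr_eq0 -lt0n.
have -> : noise k.+1 w = m%:R^-1 *: (\sum_(j < m) gradl l (x k.+1 w) (xi k.+1 j w))
   - grad f (x k.+1 w) - memory k.+1 *:
   (m%:R^-1 *: (\sum_(j < m) gradl l (x k w) (xi k.+1 j w)) - grad f (x k w)).
  rewrite /noise /increment /= sumrB sumrB -scaler_sumr sumrB.
  have mK (v : 'rV[R]_n) : m%:R^-1 *: (v *+ m) = v.
    by rewrite -[v *+ m]scaler_nat scalerA mulVf// scale1r.
  rewrite !sumr_const card_ord 2!scalerBr mK.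
  rewrite [m%:R^-1 *: (memory _ *: _)]scalerA [m%:R^-1 * _]mulrC -scalerA.
  by rewrite [m%:R^-1 *: (_ - _)]scalerBr mK.
case: k => [|k].
  by rewrite /memory eqxx !scale0r subr0 add0r /= d1.
rewrite /= dk// /memory /=.
by apply/rowP => i; rewrite !mxE; ring.
Qed.

Lemma beta_gt0 k : (1 <= k)%N -> 0 < beta k.
Proof.
move=> k1; rewrite hbeta// lt_min divr_gt0//= ?divr_gt0 ?ltr0n//.
by have := c2; lra.
Qed.

Lemma beta_le_half k : (1 <= k)%N -> beta k <= 1 / 2.
Proof. by move=> k1; rewrite hbeta// ge_min lexx. Qed.

(** The remainder in iteration [k + 1] involves the previous step, of length proportional to
    [beta k]; this trades it for [beta k.+1]. *)
Lemma beta_le_double k : (1 <= k)%N -> beta k <= 2 * beta k.+1.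
Proof.
move=> k1; have c0 : 0 < c by have := c2; lra.
rewrite !hbeta// minr_pMr//; rewrite le_min; apply/andP; split.
  by rewrite ge_min; apply/orP; left; lra.
rewrite ge_min; apply/orP; right.
rewrite mulrCA ler_pM2l// -[2](invrK 2) -invfM lef_pV2 ?posrE ?mulr_gt0 ?invr_gt0//.
rewrite mulrC ler_pdivrMr// -natrM ler_nat.
by rewrite mulnC mul2n -addnn addSn addnS !ltnS leq_addr.
Qed.

Lemma memory01 k : (1 <= k)%N -> 0 <= memory k <= 1.
Proof.
move=> k1; rewrite /memory; case: ifP => _; first by rewrite lexx ler01.
by have := beta_gt0 k1; have := beta_le_half k1; lra.
Qed.

Lemma sigma_past_sample k j : (1 <= k)%N ->
  measurable_fun [set: g_sigma_algebraType (past_events (xi := xi) k.+1)] (xi k j).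
Proof.
move=> k1 _ B mB; rewrite setTI; apply: sub_sigma_algebra.
exists k; first by rewrite /= k1 ltnSn.
by exists j => //; exists B => //; rewrite setTI.
Qed.

Lemma measurable_grad_comp (d0 : measure_display) (T0 : measurableType d0)
    (X : T0 -> Rvec R n) i : measurable_fun setT X ->
  measurable_fun setT (fun w => grad f (X w) 0 i).
Proof.
move=> mX; have [_ _ lf] := hLip.
apply: (measurable_lipschitz_factor Lg0 mX) => w w'.
have := coord_le_enorm (grad f (X w) - grad f (X w')) i; rewrite !mxE.
by move=> /le_trans; apply; exact: lf.
Qed.

Lemma measurable_gradl_comp (d0 : measure_display) (T0 : measurableType d0)
    (X : T0 -> Rvec R n) (Z : T0 -> Rvec R p) i :
  measurable_fun setT X -> measurable_fun setT Z ->
  measurable_fun setT (fun w => gradl l (X w) (Z w) 0 i).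
Proof.
move=> mX mZ; have [_ mg _] := hl.
apply: (@measurableT_comp _ _ _ _ _ _
  (fun z : Rvec R n * Rvec R p => gradl l z.1 z.2 0 i) _ (fun w => (X w, Z w))) => //.
exact: measurable_fun_pair.
Qed.

Lemma measurable_increment (d0 : measure_display) (T0 : measurableType d0)
    (X X' : T0 -> Rvec R n) (Z : T0 -> Rvec R p) (q : R) i :
  measurable_fun setT X -> measurable_fun setT X' -> measurable_fun setT Z ->
  measurable_fun setT (fun w =>
    ((gradl l (X w) (Z w) - grad f (X w)) -
     q *: (gradl l (X' w) (Z w) - grad f (X' w))) 0 i).
Proof.
move=> mX mX' mZ.
have mU (U : T0 -> Rvec R n) : measurable_fun setT U ->
    measurable_fun setT (fun w => gradl l (U w) (Z w) 0 i - grad f (U w) 0 i).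
  move=> mU; apply: measurable_funB; first exact: measurable_gradl_comp.
  exact: measurable_grad_comp.
rewrite (_ : (fun w => _) = (fun w => (gradl l (X w) (Z w) 0 i - grad f (X w) 0 i) -
  q * (gradl l (X' w) (Z w) 0 i - grad f (X' w) 0 i))).
  by apply: measurable_funB; [exact: mU|apply: measurable_funM => //; exact: mU].
by apply/funext => w; rewrite !mxE.
Qed.

(** [past_events k.+1] collects the samples of iterations [1] to [k], which determine [x k.+1] and
    the error at [k]. [x k] is carried along because the next increment evaluates gradients at both
    points. *)
Lemma iterates_measurable k :
  [/\ measurable_fun [set: g_sigma_algebraType (past_events (xi := xi) k.+1)]
        (x k.+1 : T -> Rvec R n),
      measurable_fun [set: g_sigma_algebraType (past_events (xi := xi) k.+1)]
        (x k : T -> Rvec R n) &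
      measurable_fun [set: g_sigma_algebraType (past_events (xi := xi) k.+1)]
        (est_error k : T -> Rvec R n)].
Proof.
elim: k => [|k [mx mx' me]].
  split.
  - rewrite (_ : x 1%N = cst xinit); first exact: measurable_cst.
    by apply/funext => w; have [[]] := hrun w.
  - rewrite (_ : x 0%N = cst xinit); first exact: measurable_cst.
    by apply/funext => w; have [[]] := hrun w.
  - exact: (@measurable_cst _ _ _ _ _ (0 : Rvec R n)).
have mS := @past_events_sub _ _ _ _ _ _ xi k.+1.
have {}mx := mS _ _ _ mx; have {}mx' := mS _ _ _ mx'; have {}me := mS _ _ _ me.
have me' : measurable_fun [set: g_sigma_algebraType (past_events (xi := xi) k.+2)]
    (est_error k.+1 : T -> Rvec R n).
  apply: measurable_Rvec => i.
  under eq_fun do rewrite est_error_rec !mxE summxE.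
  apply: measurable_funD; first by apply: measurable_funM => //; exact: measurable_coord.
  apply: measurable_funM => //; apply: measurable_sum => j.
  apply: measurable_increment => //; exact: sigma_past_sample.
(* [dir] is recovered as the error plus the exact gradient. *)
have md : measurable_fun [set: g_sigma_algebraType (past_events (xi := xi) k.+2)]
    (fun w => x k.+1 w - a *: dir k.+1 w : Rvec R n).
  apply: measurable_Rvec => i.
  have -> : (fun w => (x k.+1 w - a *: dir k.+1 w) 0 i) =
    (fun w => x k.+1 w 0 i - a * (est_error k.+1 w 0 i + grad f (x k.+1 w) 0 i)).
    by apply/funext => w; rewrite !mxE /=; ring.
  apply: measurable_funB; first exact: measurable_coord.
  apply: measurable_funM => //; apply: measurable_funD.
    exact: measurable_coord.
  exact: measurable_grad_comp.
split => //; apply: measurable_Rvec => i.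
have -> : (fun w => x k.+2 w 0 i) = (fun w => x k.+1 w 0 i +
    (zeta * beta k.+1) * (y k.+1 w 0 i - x k.+1 w 0 i)).
  by apply/funext => w; have [_ _ _ _ ->] := hrun w => //; rewrite !mxE.
apply: measurable_funD; first exact: measurable_coord.
apply: measurable_funM => //; apply: measurable_funB; last exact: measurable_coord.
apply: (measurable_lipschitz_factor ltr01 md) => w w'; rewrite mul1r.
have := coord_le_enorm (y k.+1 w - y k.+1 w') i; rewrite !mxE.
move=> /le_trans; apply.
have [_ _ _ + _] := hrun w; move=> /(_ k.+1 isT); rewrite halpha// => pw.
have [_ _ _ + _] := hrun w'; move=> /(_ k.+1 isT); rewrite halpha// => pw'.
exact: prox_nonexpansive pw pw'.
Qed.

(** For [k = 1] the filtration is generated by the constant [x 1], so it contains only the empty set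
    and the whole space. *)
Lemma filtration_past k : (1 <= k)%N ->
  filtration x (fun k i => xi k i : T -> Rvec R p) k `<=` <<s past_events (xi := xi) k>>.
Proof.
move=> k1; rewrite /filtration; case: ifP => [k2 A|_ A //].
move=> [B _ <-]; have mx : measurable_fun [set: g_sigma_algebraType (past_events (xi := xi) k)]
    (cst xinit : T -> Rvec R n) by exact: measurable_cst.
have -> : x 1%N = cst xinit by apply/funext => w; have [[]] := hrun w.
have [xB|xB] := pselect (B xinit).
  rewrite (_ : _ `&` _ = setT); last by rewrite setTI predeqE => w; split.
  exact: (@measurableT _ (g_sigma_algebraType (past_events (xi := xi) k))).
rewrite (_ : _ `&` _ = set0); last by rewrite setTI predeqE => w; split.
exact: sigma_algebra0.
Qed.

Lemma filtrationT k : filtration x (fun k i => xi k i : T -> Rvec R p) k setT.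
Proof.
rewrite /filtration; case: ifP => _.
  by exists setT => //; rewrite setTI preimage_setT.
exact: (@measurableT _ (g_sigma_algebraType (past_events (xi := xi) k))).
Qed.

Lemma oracle_error_ae k j : (1 <= k)%N ->
  {ae P, forall w, enorm (gradl l (x k w) (xi k j w) - grad f (x k w)) <= sigma}.
Proof.
move=> k1; have [h _ _] := hB k1.
have [|A B sA mB|_ hs] := h (xi k j).
- by move=> A mA; exact: hxi.1.
- by apply: (sample_independent_of_past hxi j k1) => //; exact: filtration_past sA.
- exact: cond_prob1_ae (filtrationT k) hs.
Qed.

Lemma dir_ae k : (1 <= k)%N -> {ae P, forall w, enorm (dir k w) <= Gd}.
Proof.
by move=> k1; have [_ _ h] := hB k1; exact: cond_prob1_ae (filtrationT k) h.
Qed.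

(** The quantifiers over [u] and [v] stay inside the almost sure event because the points inserted
    later are random. *)
Lemma gradl_lipschitz_ae k j : (1 <= k)%N -> {ae P, forall w, forall u v,
  enorm (gradl l u (xi k j w) - gradl l v (xi k j w)) <= Lg * enorm (u - v)}.
Proof.
move=> k1; have [_ _ [N [mN N0 dN]]] := hl; have [lip _ _] := hLip.
exists (xi k j @^-1` N); split.
- exact: measurable_funPTI.
- by have := hxi.1 k j N k1 mN; rewrite N0.
move=> w /= hw; apply: dN => /= hs; apply: hw => u v.
exact: lip hs.1 u v.
Qed.

Lemma step_ae k : (1 <= k)%N -> {ae P, forall w,
  enorm (x k.+1 w - x k w) <= zeta * beta k * (a * (Gd + Gr))}.
Proof.
move=> k1; have [_ hG _] := hB k1.
apply: filterS2 (dir_ae k1) hG => w hd hg.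
have [_ _ _ hp hx] := hrun w.
have [g gx] := subgradient_exists (x k w) cr.
rewrite hx// addrAC subrr add0r enormZ ger0_norm; last first.
  by rewrite mulr_ge0// ltW// beta_gt0.
rewrite ler_wpM2l//; first by rewrite mulr_ge0// ltW// beta_gt0.
have := hp _ k1; rewrite halpha// => hpk.
rewrite (le_trans (prox_step_le a0 cr hpk gx))// ler_pM2l// lerD//.
exact: hg.
Qed.

(** [2 * sigma] absorbs iteration 1, where [beta 1 = 1 / 2] and the oracle error has full weight. In
    the 4, one factor 2 counts the stochastic and the exact gradient difference, the other comes
    from [beta_le_double]. *)
Definition noise_scale : R := 2 * sigma + 4 * Lg * zeta * a * (Gd + Gr).

Lemma increment_ae k j : (1 <= k)%N ->
  {ae P, forall w, enorm (increment k j w) <= noise_scale * beta k}.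
Proof.
move=> k1; have [_ _ lipf] := hLip.
have G0 : 0 < Gd + Gr by rewrite addr_gt0.
have K0 : 0 <= 4 * Lg * zeta * a * (Gd + Gr) by rewrite !mulr_ge0// ltW.
case: k k1 => // -[_|k _].
  apply: filterS (oracle_error_ae j (ltnSn 0)) => w h.
  rewrite /increment /memory eqxx scale0r subr0 (le_trans h)//.
  have -> : beta 1 = 1 / 2.
    rewrite hbeta//; apply: min_l; rewrite ler_pM2r ?invr_gt0//.
    by have := c2; lra.
  by rewrite /noise_scale; lra.
have k1 : (1 <= k.+1)%N by [].
apply: filterS3 (oracle_error_ae j (ltn0Sn k.+1)) (gradl_lipschitz_ae j (ltn0Sn k.+1)) (step_ae k1).
move=> w h1 h2 h3; rewrite /increment /memory /=.
set A := gradl l (x k.+2 w) _ - _ in h1 *.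
set B := gradl l (x k.+1 w) _ - _.
(* The weight [beta] falls on a bounded error; the rest is a difference along one step, small by
   Lipschitz continuity. *)
have -> : A - (1 - beta k.+2) *: B = beta k.+2 *: A + (1 - beta k.+2) *: (A - B).
  by move: A B {h1} => A B; apply/rowP => i; rewrite !mxE; ring.
have b0 := beta_gt0 (ltn0Sn k.+1); have b1 := beta_le_half (ltn0Sn k.+1).
have bb := beta_le_double k1.
have AB : enorm (A - B) <= 2 * (Lg * (zeta * beta k.+1 * (a * (Gd + Gr)))).
  have -> : A - B = (gradl l (x k.+2 w) (xi k.+2 j w) - gradl l (x k.+1 w) (xi k.+2 j w)) -
      (grad f (x k.+2 w) - grad f (x k.+1 w)).
    by rewrite /A /B !opprB addrACA [in RHS]addrACA [- _ + _]addrC.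
  have h3' := ler_wpM2l (ltW Lg0) h3.
  rewrite (le_trans (ler_enormB _ _))// mulr2n mulrDl mul1r lerD//.
    exact: le_trans (h2 _ _) h3'.
  exact: le_trans (lipf _ _) h3'.
move: A B h1 AB => A B h1 AB.
rewrite (le_trans (ler_enormD _ _))// !enormZ !ger0_norm ?(ltW b0)//; last by lra.
have h4 : (1 - beta k.+2) * enorm (A - B) <= enorm (A - B).
  by rewrite ler_piMl ?enorm_ge0//; lra.
have h5 : beta k.+2 * enorm A <= beta k.+2 * sigma by rewrite ler_pM2l.
have h6 : 2 * (Lg * (zeta * beta k.+1 * (a * (Gd + Gr)))) <=
    (4 * Lg * zeta * a * (Gd + Gr)) * beta k.+2.
  have L2 : 0 <= 2 * Lg * zeta * a * (Gd + Gr) by rewrite !mulr_ge0// ltW.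
  by have := ler_wpM2l L2 bb; lra.
have h7 : 0 <= beta k.+2 * sigma by rewrite mulr_ge0// ltW.
rewrite /noise_scale mulrDl.
by lra.
Qed.

Lemma forall_ord_ae (Q : 'I_m -> T -> Prop) :
  (forall j, {ae P, forall w, Q j w}) -> {ae P, forall w, forall j, Q j w}.
Proof.
move=> h; have : {ae P, forall w, forall j, (j \in enum 'I_m) -> Q j w}.
  elim: (enum 'I_m) => [|j s IH]; first exact: aeW.
  apply: filterS2 (h j) IH => w hj hs i; rewrite inE => /orP[/eqP -> //|].
  exact: hs.
by apply: filterS => w hw j; apply: hw; rewrite mem_enum.
Qed.

Lemma noise_ae k : (1 <= k)%N ->
  {ae P, forall w, enorm (noise k w) <= noise_scale * beta k}.
Proof.
move=> k1.
apply: filterS (forall_ord_ae (fun j => increment_ae j k1)) => w h.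
have m0 : 0 < m%:R :> R by rewrite ltr0n.
rewrite /noise enormZ ger0_norm ?invr_ge0 ?ler0n// mulrC ler_pdivrMr//.
rewrite (le_trans (ler_enorm_sum _))//.
rewrite (le_trans (ler_sum _ (fun j _ => h j)))//.
by rewrite sumr_const card_ord mulr_natr.
Qed.

Lemma noise_scale_gt0 : 0 < noise_scale.
Proof.
have : 0 <= 4 * Lg * zeta * a * (Gd + Gr).
  by rewrite !mulr_ge0 ?addr_ge0// ltW.
by have := sigma0; rewrite /noise_scale; lra.
Qed.

(** A crude bound without decay, serving the integrability of the exponentials. *)
Lemma est_error_ae k : {ae P, forall w, enorm (est_error k w) <= noise_scale}.
Proof.
elim: k => [|k IH].
  by apply: aeW => w /=; rewrite enorm0 ltW// noise_scale_gt0.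
have k1 : (1 <= k.+1)%N by [].
apply: filterS2 IH (noise_ae k1) => w h1 h2; rewrite est_error_rec.
have /andP[q0 q1] := memory01 k1.
rewrite (le_trans (ler_enormD _ _))// enormZ ger0_norm//.
have b0 := beta_gt0 k1; have b1 := beta_le_half k1; have C0 := noise_scale_gt0.
have h3 : memory k.+1 * enorm (est_error k w) <= memory k.+1 * noise_scale by rewrite ler_wpM2l.
suff : memory k.+1 * noise_scale + noise_scale * beta k.+1 <= noise_scale by lra.
have : memory k.+1 + beta k.+1 <= 1 by rewrite /memory; case: ifP => _; lra.
by move=> /(ler_wpM2l (ltW C0)); lra.
Qed.

(* Freezing the past: the sample is independent of [(S, x_(k+1), x_k)]. *)
Lemma increment_centered k j (S : T -> R) (D : R) i :
  measurable_fun [set: g_sigma_algebraType (past_events (xi := xi) k.+1)] S ->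
  {ae P, forall w, `|S w| <= D} ->
  P.-integrable setT (EFin \o (fun w => expR (S w) * increment k.+1 j w 0 i)) /\
  \int[P]_w (expR (S w) * increment k.+1 j w 0 i) = 0.
Proof.
move=> mS bS; have k1 : (1 <= k.+1)%N by [].
have [mx mx' _] := iterates_measurable k.
(* The part of the integrand determined by the past; [Phi] takes it and the sample as separate
   arguments. *)
pose V w : R * (Rvec R n * Rvec R n) := (S w, (x k.+1 w, x k w)).
have mV : measurable_fun [set: g_sigma_algebraType (past_events (xi := xi) k.+1)] V.
  by apply: measurable_fun_pair => //; apply: measurable_fun_pair.
have mVT : measurable_fun [set: T] V := past_events_measurable_fun mV.
pose VX : {RV P >-> (R * (Rvec R n * Rvec R n))%type} := mfun_Sub (mem_set mVT).
pose q := memory k.+1.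
pose Phi (z : (R * (Rvec R n * Rvec R n)) * Rvec R p) : R :=
  expR z.1.1 * ((gradl l z.1.2.1 z.2 - grad f z.1.2.1) -
     q *: (gradl l z.1.2.2 z.2 - grad f z.1.2.2)) 0 i.
have m1 : measurable_fun [set: (R * (Rvec R n * Rvec R n)) * Rvec R p] (fun z => z.1.1).
  exact: (measurableT_comp measurable_fst measurable_fst).
have m2 : measurable_fun [set: (R * (Rvec R n * Rvec R n)) * Rvec R p] (fun z => z.1.2.1).
  apply: (measurableT_comp measurable_fst).
  exact: (measurableT_comp measurable_snd measurable_fst).
have m3 : measurable_fun [set: (R * (Rvec R n * Rvec R n)) * Rvec R p] (fun z => z.1.2.2).
  apply: (measurableT_comp measurable_snd).
  exact: (measurableT_comp measurable_snd measurable_fst).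
have mPhi : measurable_fun setT Phi.
  apply: measurable_funM; first exact: measurableT_comp.
  apply: measurable_increment => //; exact: measurable_snd.
have PhiE w : Phi (VX w, xi k.+1 j w) = expR (S w) * increment k.+1 j w 0 i by [].
have iPhi : P.-integrable setT (EFin \o (fun w => expR (S w) * increment k.+1 j w 0 i)).
  apply: (@ae_bounded_integrable _ _ _ _ _ (expR D * (noise_scale * beta k.+1))).
    have mc : measurable_fun setT (fun w => (VX w, xi k.+1 j w)) by exact: measurable_fun_pair.
    exact: (measurableT_comp mPhi mc).
  apply: filterS2 bS (increment_ae j k1) => w /ler_normlP[_ hS] hi.
  rewrite normrM ger0_norm ?expR_ge0//; apply: ler_pM; rewrite ?expR_ge0// ?ler_expR//.
  exact: le_trans (coord_le_enorm _ _) hi.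
split => //.
rewrite /Rintegral (@freezing_integral_eq0 _ _ _ _ _ _ _ P Pxi VX (xi k.+1 j) _ _ Phi)//.
- by move=> B mB; exact: hxi.1.
- move=> A B mA mB; apply: (sample_independent_of_past hxi j k1) => //.
  by have := mV measurableT A mA; rewrite setTI.
move=> [s [u v]]; rewrite /Phi /=.
have ig z : Pxi.-integrable setT (EFin \o (fun t => gradl l z t 0 i)) :=
  integrable_gradl hl (ltW Lg0) hLip z i.
have ic (e : R) : Pxi.-integrable setT (EFin \o (fun=> e)) by exact/finite_measure_integrable_cst.
have id z : Pxi.-integrable setT (EFin \o (fun t => gradl l z t 0 i - grad f z 0 i)).
  by have := integrableB measurableT (ig z) (ic (grad f z 0 i)).
have id0 z : \int[Pxi]_t (gradl l z t 0 i - grad f z 0 i) = 0.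
  by rewrite RintegralB// (expected_gradl hl (ltW Lg0) hLip) Rintegral_cstT subrr.
have iq z : Pxi.-integrable setT (EFin \o (fun t => q * (gradl l z t 0 i - grad f z 0 i))).
  by have := integrableZl measurableT q (id z).
have it : Pxi.-integrable setT (EFin \o (fun t => (gradl l u t 0 i - grad f u 0 i) -
    q * (gradl l v t 0 i - grad f v 0 i))).
  by have := integrableB measurableT (id u) (iq v).
have it' : Pxi.-integrable setT (EFin \o (fun t => expR s * ((gradl l u t 0 i - grad f u 0 i) -
    q * (gradl l v t 0 i - grad f v 0 i)))).
  by have := integrableZl measurableT (expR s) it.
rewrite (eq_integral (EFin \o (fun t => expR s * ((gradl l u t 0 i - grad f u 0 i) -
    q * (gradl l v t 0 i - grad f v 0 i))))); last first.
  by move=> t _; rewrite /= !mxE.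
rewrite -[LHS]fineK; last exact: integrable_fin_num.
rewrite -[fine _]/(\int[Pxi]_t _) RintegralZl// RintegralB// RintegralZl// !id0.
by rewrite mulr0 subrr mulr0.
Qed.

Lemma noise_centered k (S : T -> R) (D : R) i :
  measurable_fun [set: g_sigma_algebraType (past_events (xi := xi) k.+1)] S ->
  {ae P, forall w, `|S w| <= D} ->
  \int[P]_w (expR (S w) * noise k.+1 w 0 i) = 0.
Proof.
move=> mS bS.
pose g j w := expR (S w) * increment k.+1 j w 0 i.
have hg j : P.-integrable setT (EFin \o g j) /\ \int[P]_w g j w = 0 by exact: increment_centered bS.
have hs (s : seq 'I_m) : P.-integrable setT (EFin \o (fun w => \sum_(j <- s) g j w)) /\
    \int[P]_w (\sum_(j <- s) g j w) = 0.
  elim: s => [|j s [IH1 IH2]].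
    under eq_fun do rewrite big_nil.
    split; first exact/finite_measure_integrable_cst.
    by rewrite Rintegral_cstT.
  have -> : (fun w => \sum_(j0 <- (j :: s)) g j0 w) = (fun w => g j w + \sum_(j0 <- s) g j0 w).
    by apply/funext => w; rewrite big_cons.
  have [i1 i2] := hg j; split; first by have := integrableD measurableT i1 IH1.
  by rewrite RintegralD// i2 IH2 addr0.
have [h1 h2] := hs (index_enum 'I_m).
have -> : (fun w => expR (S w) * noise k.+1 w 0 i) = (fun w => m%:R^-1 * \sum_(j < m) g j w).
  apply/funext => w; rewrite /noise mxE summxE mulrCA; congr (_ * _).
  by rewrite mulr_sumr.
by rewrite RintegralZl// h2 mulr0.
Qed.

(** Normalized by moment bounds [expR (3 * lam ^+ 2 * v)], so the usual variance proxy is 6 times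
    this. *)
Definition variance_proxy (k : nat) : R := (noise_scale * c) ^+ 2 / k.+1%:R.

Lemma variance_proxy_rec k :
  memory k.+1 ^+ 2 * variance_proxy k + (noise_scale * beta k.+1) ^+ 2 <= variance_proxy k.+1.
Proof.
have c0 := c2; have C0 := noise_scale_gt0.
rewrite /variance_proxy /memory hbeta//; case: k => [|k]; last exact: variance_proxy_step.
rewrite /= expr0n /= mul0r add0r.
set b := Num.min _ _.
have b1 : b <= 1 / 2 by rewrite ge_min lexx.
have b0 : 0 <= b by rewrite le_min; apply/andP; split; rewrite divr_ge0//; lra.
clearbody b; rewrite !exprMn -[leRHS]mulrA ler_wpM2l ?sqr_ge0//; nra.
Qed.

(** [lam] is general in the induction because the recursion passes [lam * memory k.+1] to the
    previous error. *)
Lemma est_error_mgf k i lam :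
  \int[P]_w expR (lam * est_error k w 0 i) <= expR (3 * lam ^+ 2 * variance_proxy k).
Proof.
elim: k lam => [|k IH] lam.
  rewrite /=; under eq_Rintegral do rewrite mxE mulr0 expR0.
  rewrite Rintegral_cstT -[leLHS]expR0 ler_expR.
  by apply: mulr_ge0; [rewrite mulr_ge0 ?sqr_ge0|rewrite /variance_proxy divr_ge0 ?sqr_ge0].
have k1 : (1 <= k.+1)%N by [].
have [mx mx' me] := iterates_measurable k.
pose S w := (lam * memory k.+1) * est_error k w 0 i.
have mS : measurable_fun [set: g_sigma_algebraType (past_events (xi := xi) k.+1)] S.
  by apply: measurable_funM => //; exact: measurable_coord.
have bS : {ae P, forall w, `|S w| <= `|lam * memory k.+1| * noise_scale}.
  apply: filterS (est_error_ae k) => w h; rewrite normrM ler_wpM2l//.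
  exact: le_trans (coord_le_enorm _ _) h.
have mN : measurable_fun [set: T] (fun w => noise k.+1 w 0 i).
  have -> : (fun w => noise k.+1 w 0 i) =
      (fun w => est_error k.+1 w 0 i - memory k.+1 * est_error k w 0 i).
    by apply/funext => w; rewrite est_error_rec !mxE; ring.
  have [_ _ me'] := iterates_measurable k.+1.
  apply: measurable_funB; first exact: measurable_coord (past_events_measurable_fun me').
  by apply: measurable_funM => //; exact: measurable_coord (past_events_measurable_fun me).
have b0 := beta_gt0 k1; have C0 := noise_scale_gt0.
have bN : {ae P, forall w, `|lam * noise k.+1 w 0 i| <= `|lam| * (noise_scale * beta k.+1)}.
  apply: filterS (noise_ae k1) => w h; rewrite normrM ler_wpM2l//.
  exact: le_trans (coord_le_enorm _ _) h.
have mST : measurable_fun [set: T] S := past_events_measurable_fun mS.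
have mN' : measurable_fun [set: T] (fun w => lam * noise k.+1 w 0 i) by apply: measurable_funM.
have z0 : \int[P]_w (expR (S w) * (lam * noise k.+1 w 0 i)) = 0.
  have z1 := noise_centered i mS bS.
  have -> : (fun w => expR (S w) * (lam * noise k.+1 w 0 i)) =
    (fun w => lam * (expR (S w) * noise k.+1 w 0 i)) by apply/funext => w; rewrite mulrCA.
  rewrite RintegralZl// ?z1 ?mulr0//.
  apply: (@ae_bounded_integrable _ _ _ _ _
    (expR (`|lam * memory k.+1| * noise_scale) * (noise_scale * beta k.+1))).
    by apply: measurable_funM => //; exact: measurableT_comp.
  apply: filterS2 bS (noise_ae k1) => w /ler_normlP[_ hS] hi.
  rewrite normrM ger0_norm ?expR_ge0//; apply: ler_pM; rewrite ?expR_ge0// ?ler_expR//.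
  exact: le_trans (coord_le_enorm _ _) hi.
have := mgf_step mST mN' bS bN z0.
have -> : (fun w => expR (S w + lam * noise k.+1 w 0 i)) =
    (fun w => expR (lam * est_error k.+1 w 0 i)).
  by apply/funext => w; rewrite est_error_rec !mxE /S; congr expR; ring.
move=> h; apply: (le_trans h).
have := ler_wpM2l (expR_ge0 (3 * (`|lam| * (noise_scale * beta k.+1)) ^+ 2))
  (IH (lam * memory k.+1)).
move=> {}h; apply: (le_trans h); rewrite -expRD ler_expR.
rewrite !exprMn real_normK ?num_real//.
move: (variance_proxy_rec k); rewrite exprMn.
move: (variance_proxy k) (variance_proxy k.+1) => v v' hv.
by have := ler_wpM2l (sqr_ge0 lam) hv; lra.
Qed.

Lemma est_error_tail k i t : 0 < t ->
  (P [set w | (t <= `|est_error k w 0 i|)%R] <=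
    (2 * expR (- (t ^+ 2 / (12 * variance_proxy k))))%:E)%E.
Proof.
move=> t0; have [_ _ me] := iterates_measurable k.
have mX := measurable_coord i (past_events_measurable_fun me).
pose X : {RV P >-> R} := mfun_Sub (mem_set mX).
apply: (@subgaussian_tail _ _ _ P X noise_scale) => //.
- rewrite /variance_proxy divr_gt0 ?ltr0n// exprn_gt0// mulr_gt0 ?noise_scale_gt0//.
  by have := c2; lra.
- by apply: filterS (est_error_ae k) => w h; exact: le_trans (coord_le_enorm _ _) h.
- by move=> lam; exact: est_error_mgf.
Qed.

End storm.

(** * Concentration uniform in time by a union bound *)

Section concentration.
Context {R : realType} {d : measure_display} {T : measurableType d}.
Variable P : probability T R.

Lemma measure_bigcup_le_bound (B : nat -> set T) (u : nat -> R) (s : R) :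
  (forall k, measurable (B k)) -> (forall k, (P (B k) <= (u k)%:E)%E) ->
  (forall N, \sum_(0 <= k < N) u k <= s) -> (P (\bigcup_k B k) <= s%:E)%E.
Proof.
move=> mB PB us.
apply: (le_trans (@measure_sigma_subadditive _ _ _ P (\bigcup_k B k) B mB _ _)) => //.
  exact: bigcupT_measurable.
apply: lime_le; first by apply: is_cvg_nneseries => k _ _.
apply: nearW => N; apply: (@le_trans _ _ (\sum_(0 <= k < N) (u k)%:E)%E).
  by apply: lee_sum => k _; exact: PB.
by rewrite sumEFin lee_fin.
Qed.

Lemma measure_bigsetU_le (I : Type) (s : seq I) (B : I -> set T) :
  (forall i, measurable (B i)) ->
  (P (\big[setU/set0]_(i <- s) B i) <= \sum_(i <- s) P (B i))%E.
Proof.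
move=> mB; elim: s => [|i s IH]; first by rewrite !big_nil measure0.
have ms : measurable (\big[setU/set0]_(j <- s) B j) by apply: bigsetU_measurable.
rewrite !big_cons (le_trans (measureU2 _ (mB i) ms))//.
exact: leeD.
Qed.

(* The constant 1/4 comes from [1/k^2 <= 2 (1/k - 1/(k+1))], and the exponent
   [tau = 2 + ln (4n+1) / ln (2/eta)] absorbs the union over coordinates. *)
Lemma coordinatewise_subgaussian_bound (n : nat) (err : nat -> T -> 'rV[R]_n) (V eta : R) :
  0 < V -> 0 < eta < 3 / 2 ->
  (forall k i, measurable_fun setT (fun w => err k w 0 i)) ->
  (forall k i t, 0 < t -> (P [set w | (t <= `|err k w 0 i|)%R] <=
     (2 * expR (- (t ^+ 2 / (12 * (V / k.+1%:R)))))%:E)%E) ->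
  exists B : R, exists A : set T,
  [/\ 0 <= B, measurable A, ((1 - eta ^+ 2 / 4)%:E <= P A)%E &
    forall w k, A w -> (1 <= k)%N ->
      enorm (err k w) ^+ 2 <= B * (ln (2 * k%:R / eta) / k.+1%:R)].
Proof.
move=> V0 /andP[e0 e2] merr tail.
pose L (k : nat) := ln (2 * k%:R / eta).
have L1 : 0 < L 1%N.
  by rewrite /L ln_gt0// mulr1 ltr_pdivlMr// mul1r; lra.
have LL k : (1 <= k)%N -> L 1%N <= L k.
  move=> k1; rewrite /L ler_ln ?posrE ?divr_gt0 ?mulr_gt0 ?ltr0n//.
  by rewrite ler_pM2r ?invr_gt0// ler_pM2l// ler_nat.
pose s := ln (4 * n%:R + 1) / L 1%N; pose tau := 2 + s.
have n0 : 0 <= n%:R :> R by rewrite ler0n.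
have s0 : 0 <= s by rewrite divr_ge0 ?(ltW L1)// ln_ge0//; lra.
have tau0 : 0 < tau by rewrite /tau; lra.
(* Squared threshold at which the tail exponent at time [k] is exactly [tau * L k]. *)
pose t2 (k : nat) := 12 * V * tau * (L k / k.+1%:R).
have t20 k : (1 <= k)%N -> 0 < t2 k.
  by move=> k1; rewrite !mulr_gt0 ?invr_gt0 ?ltr0n// (lt_le_trans L1)// LL.
pose bad k : set T := \big[setU/set0]_(i < n) [set w | Num.sqrt (t2 k) <= `|err k w 0 i|].
have mbad1 k (i : 'I_n) : measurable [set w | Num.sqrt (t2 k) <= `|err k w 0 i|].
  have mf : measurable_fun setT (fun w => `|err k w 0 i|) by apply: measurableT_comp.
  have := mf measurableT `[Num.sqrt (t2 k), +oo[%classic (measurable_itv _).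
  by rewrite setTI [X in measurable X -> _](_ : _ = [set w | Num.sqrt (t2 k) <= `|err k w 0 i|])//
    predeqE => w /=; rewrite in_itv/= andbT.
have mbad k : measurable (bad k) by apply: bigsetU_measurable.
pose u (k : nat) : R := eta ^+ 2 / 4 * (k.+1%:R^-1 - k.+2%:R^-1).
have Pbad k : (P (bad k.+1) <= (u k)%:E)%E.
  have k1 : (1 <= k.+1)%N by [].
  apply: (@le_trans _ _ (\sum_(i < n) P [set w | (Num.sqrt (t2 k.+1) <= `|err k.+1 w 0 i|)%R])%E).
    exact: measure_bigsetU_le.
  apply: (@le_trans _ _ (\sum_(i < n) (2 * expR (- (tau * L k.+1)))%:E)%E).
    apply: lee_sum => i _.
    have := tail k.+1 i (Num.sqrt (t2 k.+1)); rewrite sqrtr_gt0 t20// => /(_ isT).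
    rewrite sqr_sqrtr ?(ltW (t20 _ k1))//.
    have -> : t2 k.+1 / (12 * (V / k.+2%:R)) = tau * L k.+1.
      by rewrite /t2; field; rewrite gt_eqF//= gt_eqF// ltr0n.
    by [].
  rewrite sumEFin lee_fin sumr_const card_ord -[leLHS]mulr_natl.
  (* The summand [s] of [tau] gives the first factor, which beats the [2 * n] tails; the summand 2
     gives the summable square. The [+ 1] keeps the logarithm in [s] nonnegative when [n = 0]. *)
  have eL : expR (- (tau * L k.+1)) <= (4 * n%:R + 1)^-1 * (eta / (2 * k.+1%:R)) ^+ 2.
    have -> : - (tau * L k.+1) = - (s * L k.+1) + 2%:R * - L k.+1 by rewrite /tau; ring.
    rewrite expRD expRM_natl; apply: ler_pM; rewrite ?expR_ge0 ?exprn_ge0 ?expR_ge0//.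
      have -> : (4 * n%:R + 1)^-1 = expR (- ln (4 * n%:R + 1)) :> R.
        by rewrite expRN lnK// posrE; lra.
      rewrite ler_expR lerN2 -[leLHS](divfK (lt0r_neq0 L1)) -/s.
      by rewrite ler_wpM2l// LL.
    rewrite expRN lnK ?posrE ?divr_gt0 ?mulr_gt0 ?ltr0n//.
    by rewrite invf_div.
  have kR : 0 < k.+1%:R :> R by rewrite ltr0n.
  have h : 2 * n%:R * (4 * n%:R + 1)^-1 <= 1 / 2 :> R.
    by rewrite ler_pdivrMr; lra.
  have h2 : (eta / (2 * k.+1%:R)) ^+ 2 <= 2 * u k.
    rewrite /u -[k.+2%:R]natr1; set K := k.+1%:R in kR *.
    have K1 : 1 <= K by rewrite /K ler1n.
    rewrite -subr_ge0.
    have -> : 2 * (eta ^+ 2 / 4 * (K^-1 - (K + 1)^-1)) - (eta / (2 * K)) ^+ 2 =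
      eta ^+ 2 * (K - 1) / (4 * K ^+ 2 * (K + 1)).
      by field; rewrite !gt_eqF//; lra.
    by rewrite divr_ge0 ?mulr_ge0 ?sqr_ge0//; lra.
  have u0 : 0 <= (eta / (2 * k.+1%:R)) ^+ 2 by exact: sqr_ge0.
  have n20 : 0 <= 2 * n%:R :> R by lra.
  have h3 := ler_wpM2l n20 eL; rewrite mulrA in h3.
  have h4 := ler_wpM2r u0 h.
  by rewrite mulrA [_ * 2]mulrC (le_trans h3)// (le_trans h4)//
    mulrC mulrA mulr1 ler_pdivrMr// [leRHS]mulrC.
have sumu N : \sum_(0 <= k < N) u k <= eta ^+ 2 / 4.
  rewrite -mulr_sumr -[leRHS]mulr1 ler_wpM2l ?divr_ge0 ?sqr_ge0//.
  have -> : \sum_(0 <= k < N) (k.+1%:R^-1 - k.+2%:R^-1) = 1 - N.+1%:R^-1 :> R.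
    elim: N => [|N IH]; first by rewrite big_geq// invr1 subrr.
    by rewrite big_nat_recr//= IH addrA subrK.
  by rewrite gerBl invr_ge0.
pose Bad := \bigcup_k bad k.+1.
have mBad : measurable Bad by apply: bigcupT_measurable => k.
have PBad : (P Bad <= (eta ^+ 2 / 4)%:E)%E.
  exact: (measure_bigcup_le_bound (fun k => mbad k.+1) Pbad sumu).
exists (n%:R * (12 * V * tau)), (~` Bad); split.
- by rewrite !mulr_ge0// ltW.
- exact: measurableC.
- by rewrite probability_setC// EFinB leeB.
move=> w k nB k1.
have hk i : err k w 0 i ^+ 2 <= t2 k.
  have : ~ Num.sqrt (t2 k) <= `|err k w 0 i|.
    move=> h; apply: nB; exists k.-1 => //; rewrite prednK//.
    by rewrite /bad -bigcup_seq; exists i => //=; rewrite mem_index_enum.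
  move/negP; rewrite -ltNge => h; rewrite -[leRHS]sqr_sqrtr ?(ltW (t20 k k1))//.
  by rewrite -real_normK ?num_real// ler_pXn2r ?nnegrE ?sqrtr_ge0// ltW.
rewrite sqr_enorm /dotp; apply: (@le_trans _ _ (\sum_(i < n) t2 k)).
  by apply: ler_sum => i _; rewrite -expr2.
by rewrite sumr_const card_ord -[leLHS]mulr_natl -/(L k) -[leRHS]mulrA.
Qed.

End concentration.

(** * The threshold index and the choice of [C3] *)

(** From this index on [c / (k + 1) <= 1 / 2], so the minimum defining [beta k] is [c / (k + 1)].
    The sign condition makes the absolute value of the ceiling the ceiling itself. *)
Lemma ceil_kbar_ge (R : realType) (c : R) (k : nat) : 0 <= 2 * c - 1 ->
  (`|Num.ceil (2 * c - 1)| <= k)%N -> 2 * c <= k.+1%:R.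
Proof.
move=> c0 hk; rewrite -[k.+1%:R]natr1 -lerBlDr (le_trans (ceil_ge _))//.
have z0 : 0 <= Num.ceil (2 * c - 1) by rewrite ceil_ge0; lra.
by rewrite -[Num.ceil _]gez0_abs// pmulrn ler_nat.
Qed.

Lemma mulr_le1_half (R : realType) (z b : R) :
  0 < z < 2 -> 0 <= b <= 1 / 2 -> 0 <= z * b <= 1.
Proof. by move=> /andP[z0 z2] /andP[b0 b2]; apply/andP; split; nra. Qed.

Lemma ler_div_half (R : realType) (c s : R) : 0 < s -> 2 * c <= s -> c / s <= 1 / 2.
Proof. by move=> s0 cs; rewrite ler_pdivrMr//; lra. Qed.

Theorem theorem3p6 (R : realType) (n p m nG : nat)
  (d : measure_display) (T : measurableType d) (P : probability T R)
  (Pxi : probability (Rvec R p) R) (l : 'rV[R]_n -> Rvec R p -> R)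
  (g : 'I_nG -> {set 'I_n}) (r_ : forall i : 'I_nG, 'rV[R]_#|g i| -> R)
  (xi : nat -> 'I_m -> {RV P >-> Rvec R p})
  (xinit : 'rV[R]_n) (beta alpha : nat -> R)
  (x dir y : nat -> T -> 'rV[R]_n) (xstar : 'rV[R]_n)
  (muf Lg Gr sigma Gd zeta theta c eta0 : R)
  (f := expected_loss Pxi l) (r := group_sum r_)
  (hm : (0 < m)%N)
  (hl : stochastic_loss Pxi l)
  (hg : group_partition g)
  (hxi : iid_samples Pxi xi)
  (hrun : S_PStorm r l (fun k i => xi k i : T -> Rvec R p)
            xinit beta alpha zeta x dir y)
  (hmuf : 0 < muf) (hf : strongly_convex muf f)
  (hr : forall i, closed_function (r_ i) /\ convex_on_space (r_ i))
  (hLg : 0 < Lg) (hLip : lipschitz_gradients Lg Pxi l)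
  (hGr : 0 < Gr) (hsigma : 0 < sigma) (hGd : 0 < Gd)
  (hB : oracle_and_iterate_bounds Pxi l r xi x dir Gr sigma Gd)
  (hbeta : forall k, (1 <= k)%N -> beta k = Num.min (1 / 2) (c / (k.+1)%:R))
  (halpha : forall k, (1 <= k)%N -> alpha k = muf / Lg ^+ 2)
  (hzeta : 0 < zeta < 2)
  (htheta : 2 <= theta)
  (hc : c = (2 * theta * Lg ^+ 2) / (zeta * muf ^+ 2)) (hc2 : 2 < c)
  (heta0 : 0 < eta0 < 6 / pi ^+ 2)
  (hxstar : argmin (fun z => f z + r z) = [set xstar]) :
  exists C3 : R, 0 < C3 /\
    let kbar := `|Num.ceil (2 * c - 1)|%N in
    let c1 := (kbar + 2)%:R `^ theta in
    let c2 := C3 * zeta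
              * (muf ^+ 2 / Lg ^+ 4 + 2 / Lg ^+ 2 * (1 + muf / Lg) ^+ 2)
              * (sigma + Lg * (Gr + Gd) * zeta * (muf / Lg ^+ 2)) ^+ 2 in
    let E k := [set w : T |
      enorm (x k w - xstar) ^+ 2 <=
        c1 * (enorm (x kbar w - xstar) ^+ 2 / k%:R `^ theta)
        + c2 * (ln (2 * k%:R / eta0) / k%:R)] in
    ((1 - eta0 * pi ^+ 2 / 6)%:E <=
       P (\bigcap_(k in [set k | (kbar <= k)%N]) E k))%E
    /\ 0 < 1 - eta0 * pi ^+ 2 / 6.
Proof.
have a0 : 0 < muf / Lg ^+ 2 by rewrite divr_gt0// exprn_gt0.
have cr : jensen r.
  by apply: group_sum_jensen => i; apply: convex_on_space_jensen; exact: (hr i).2.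
have /andP[z0 z2] := hzeta.
have /andP[e0 epi] := heta0.
(* This crude bound suffices both for [eta0 < 3 / 2] and for the comparison of probabilities at the
   end. *)
have pi2 : 4 <= pi ^+ 2 :> R.
  have -> : 4 = 2 ^+ 2 :> R by rewrite -natrX.
  by rewrite ler_pXn2r ?nnegrE ?pi_ge0// pi_ge2.
have pi0 : 0 < pi ^+ 2 :> R by lra.
have e32 : eta0 < 3 / 2.
  by move: epi; rewrite ltr_pdivlMr// => h; nra.
have fin0 : 0 < 1 - eta0 * pi ^+ 2 / 6.
  by move: epi; rewrite ltr_pdivlMr// => h; lra.
have mvec k : measurable_fun [set: T] (x k : T -> Rvec R n).
  have [_ + _] := iterates_measurable hm hl hrun cr hLg hLip halpha a0 k.
  exact: past_events_measurable_fun.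
pose err := est_error Pxi l x dir.
have merr k i : measurable_fun setT (fun w => err k w 0 i).
  have [_ _ me] := iterates_measurable hm hl hrun cr hLg hLip halpha a0 k.
  exact: (measurable_coord i (past_events_measurable_fun me)).
pose V := (noise_scale Lg Gr sigma Gd zeta (muf / Lg ^+ 2) * c) ^+ 2.
have V0 : 0 < V.
  rewrite exprn_gt0// mulr_gt0//; last by lra.
  exact: (noise_scale_gt0 hLg hGr hsigma hGd a0 z0).
have tail k i t : 0 < t -> (P [set w | (t <= `|err k w 0 i|)%R] <=
     (2 * expR (- (t ^+ 2 / (12 * (V / k.+1%:R)))))%:E)%E.
  exact: (est_error_tail hm hl hxi hrun cr hLg hLip hGr hsigma hGd hB
    hbeta halpha a0 z0 hc2 k i).
have e032 : 0 < eta0 < 3 / 2 by rewrite e0 e32.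
have [B [A [B0 mA PA HA]]] := coordinatewise_subgaussian_bound V0 e032 merr tail.
pose kappa := muf ^+ 2 / Lg ^+ 2.
have kappa0 : 0 < kappa by rewrite divr_gt0// exprn_gt0.
pose G := (1 + 2 / kappa) * (muf / Lg ^+ 2) ^+ 2.
have G0 : 0 <= G by rewrite mulr_ge0 ?sqr_ge0// addr_ge0// divr_ge0// ltW.
have c0 : 0 < c by lra.
(* [zeta * c] comes from the relaxation weight, [G] from the contraction, [B] from the concentration
   bound. *)
pose K := zeta * c * (G * B).
have K0 : 0 <= K := mulr_ge0 (mulr_ge0 (ltW z0) (ltW c0)) (mulr_ge0 G0 B0).
pose S := zeta * (muf ^+ 2 / Lg ^+ 4 + 2 / Lg ^+ 2 * (1 + muf / Lg) ^+ 2)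
              * (sigma + Lg * (Gr + Gd) * zeta * (muf / Lg ^+ 2)) ^+ 2.
have S0 : 0 < S.
  apply: mulr_gt0; [apply: mulr_gt0 => //|apply: exprn_gt0].
    apply: addr_gt0; first by rewrite divr_gt0// exprn_gt0.
    apply: mulr_gt0; first by rewrite divr_gt0// exprn_gt0.
    by rewrite exprn_gt0// addr_gt0// divr_gt0.
  apply: addr_gt0 => //; apply: mulr_gt0 => //; apply: mulr_gt0 => //.
  by apply: mulr_gt0 => //; exact: addr_gt0.
(* [S] is the prescribed factor next to [C3], so [C3 * S = K + 1]; adding 1 makes [C3] positive even
   if [K = 0]. *)
exists ((K + 1) / S); split; first by rewrite divr_gt0//; lra.
move=> kbar c1 c2' E; split; last exact: fin0.
have c2E : c2' = K + 1.
  have -> : c2' = (K + 1) / S * S by rewrite /c2' -!(mulrA ((K + 1) / S)).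
  by rewrite divfK// gt_eqF.
have kge k : (kbar <= k)%N -> 2 * c <= k.+1%:R.
  by apply: ceil_kbar_ge; lra.
have kbar0 : (0 < kbar)%N.
  by have := kge _ (leqnn _); case: (kbar) => // h; lra.
have Elnk k : (kbar <= k)%N -> 0 <= ln (2 * k%:R / eta0) / k%:R.
  move=> kk; have k1 : 1 <= k%:R :> R by rewrite ler1n (leq_trans kbar0).
  by rewrite divr_ge0// ln_ge0// ler_pdivlMr//; lra.
have mE k : measurable (E k).
  pose h w := enorm (x k w - xstar) ^+ 2 - (c1 * (enorm (x kbar w - xstar) ^+ 2 / k%:R `^ theta)
        + c2' * (ln (2 * k%:R / eta0) / k%:R)).
  have mn j : measurable_fun [set: T] (fun w => enorm (x j w - xstar) ^+ 2).
    apply: measurable_funX; apply: (@measurable_enorm _ T R n (fun w => x j w - xstar)).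
    apply: measurable_Rvec => i; under eq_fun do rewrite !mxE.
    by apply: measurable_funB => //; exact: measurable_coord.
  have mh : measurable_fun [set: T] h.
    apply: measurable_funB => //; apply: measurable_funD => //.
    by apply: measurable_funM => //; apply: measurable_funM.
  have := mh measurableT `]-oo, 0]%classic (measurable_itv _).
  rewrite setTI [X in measurable X -> _](_ : _ = E k)//.
  by rewrite predeqE => w /=; rewrite in_itv /= /h subr_le0.
(* This inclusion is pathwise: the algorithm's relations hold for every [w], and membership in [A]
   supplies the error bound for all times at once. *)
have AE : A `<=` \bigcap_(k in [set k | (kbar <= k)%N]) E k.
  move=> w Aw k /= kk; rewrite /E /= c2E.
  have hrec j : (kbar <= j)%N -> enorm (x j.+1 w - xstar) ^+ 2 <=
      (1 - theta / j.+1%:R) * enorm (x j w - xstar) ^+ 2 +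
      K * (ln (2 * j%:R / eta0) / (j%:R * j.+1%:R)).
    move=> kj; have j1 : (1 <= j)%N by rewrite (leq_trans kbar0).
    have [_ _ _ hp hx] := hrun w.
    have jS : 0 < j.+1%:R :> R by rewrite ltr0n.
    have jR : 0 < j%:R :> R by rewrite ltr0n.
    have jj : j%:R <= j.+1%:R :> R by rewrite ler_nat.
    have b2 : c / j.+1%:R <= 1 / 2 := ler_div_half jS (kge _ kj).
    have bE : beta j = c / j.+1%:R by rewrite hbeta//; exact: min_r.
    have b0 : 0 <= c / j.+1%:R by rewrite divr_ge0// ltW.
    have zb : 0 <= zeta * beta j <= 1.
      by rewrite bE; apply: mulr_le1_half => //; rewrite b0 b2.
    have hpj := hp _ j1; rewrite halpha// in hpj.
    have [_ df lipf] := hLip.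
    have mxs : argmin (fun z => f z + r z) xstar by rewrite hxstar.
    have := relaxed_step_recursion hLg hmuf df lipf hf cr mxs hpj zb.
    rewrite -hx// => h; apply: (le_trans h).
    (* The value of [c] is made for this identity. *)
    have -> : zeta * beta j * (muf ^+ 2 / Lg ^+ 2 / 2) = theta / j.+1%:R.
      by rewrite bE hc; field; rewrite !gt_eqF.
    rewrite lerD2l -/kappa -/G bE.
    have he := HA w j Aw j1.
    have errE : err j w = dir j w - grad f (x j w) by rewrite /err; case: (j) j1.
    rewrite errE in he.
    have zc0 : 0 <= zeta * (c / j.+1%:R) by rewrite mulr_ge0// ltW.
    apply: (le_trans (ler_wpM2l zc0 (ler_wpM2l G0 he))).
    have l0 : 0 <= ln (2 * j%:R / eta0) / j%:R by exact: Elnk.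
    (* One of the two factors [1 / (j + 1)] is relaxed to [1 / j] to fit [polynomial_decay]. *)
    have l1 : ln (2 * j%:R / eta0) / j.+1%:R <= ln (2 * j%:R / eta0) / j%:R.
      rewrite ler_wpM2l ?lef_pV2 ?posrE//.
      by rewrite -[X in 0 <= X](divfK (lt0r_neq0 jR)) mulr_ge0// ltW.
    have KS0 : 0 <= K / j.+1%:R by rewrite divr_ge0// ltW.
    apply: (@le_trans _ _ (K / j.+1%:R * (ln (2 * j%:R / eta0) / j.+1%:R))).
      by rewrite le_eqVlt; apply/orP; left; apply/eqP; rewrite /K; field; rewrite gt_eqF.
    apply: (le_trans (ler_wpM2l KS0 l1)).
    by rewrite le_eqVlt; apply/orP; left; apply/eqP; field; rewrite !gt_eqF.
  have e02 : 0 < eta0 < 2 by rewrite e0 /=; lra.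
  have D0 j : 0 <= enorm (x j w - xstar) ^+ 2 by exact: sqr_ge0.
  have := polynomial_decay kbar0 htheta K0 e02 D0 hrec kk.
  move=> h; apply: (le_trans h); rewrite lerD2l.
  by rewrite ler_wpM2r ?Elnk// lerDl.
have mEE : measurable (\bigcap_(k in [set k | (kbar <= k)%N]) E k).
  by apply: bigcap_measurableType => k _.
apply: (@le_trans _ _ (P A)); last by apply: le_measure => //; rewrite inE.
apply: le_trans PA; rewrite lee_fin lerD2l lerN2.
(* The failure probability is at most [3 / 8 * eta0], below [2 / 3 * eta0] and hence below the
   allowed [eta0 * pi ^+ 2 / 6]. *)
have : eta0 ^+ 2 / 4 <= eta0 * (3 / 8) by nra.
have : eta0 * 4 <= eta0 * pi ^+ 2 by rewrite ler_pM2l.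
lra.
Qed.
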